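(* Let $x,z$ be nonnegative integers with $x\equiv z\pmod 2$, let $\mathbf a=(a_1,\dots,a_m)$, $\mathbf b=(b_1,\dots,b_n)$, $\mathbf c=(c_1,\dots,c_k)$ be sequences of nonnegative integers with $m,n,k$ positive even integers, and let $y$ be an integer with $y\ge 0$ if $b\le a$ and $y\ge -1$ if $b>a$. Put $h=\frac{x+z}{2}$, $\mu=\max(a,b)$, $\nu=\min(a,b)$. Then \begin{align*} \operatorname{M}(R^{\nwarrow}_{x,y,z}(\mathbf a;\mathbf c;\mathbf b))=&\operatorname{M}(C_{x,2y+z+2\mu+1,z}(c))\\ &\times s\left(y+b-\nu,a_1,\dots,a_m,h,c_1,\dots,c_{k-1},c_k+h+b_n,b_{n-1},\dots,b_1\right)\\ &\times s\left(a_1,\dots,a_{m-1},a_m+h+c_1,c_2,\dots,c_k,h,b_n,\dots,b_1,y+a+1-\nu\right)\\ &\times\frac{\operatorname{H}(c+h)}{\operatorname{H}(c)\operatorname{H}(h)}\frac{\operatorname{H}(\mu+y+h)}{\operatorname{H}(\mu+c+y+h)}\\ &\times \frac{\operatorname{H}(\mu+y+z+1)\operatorname{H}(\mu+c+y+z)}{\operatorname{H}(\mu-o_a+o_b+o_c+y+z)\operatorname{H}(\mu+o_a-o_b+e_c+y+z+1)}\\ &\times \frac{\operatorname{H}(\mu-o_a+o_b+o_c+y)\operatorname{H}(\mu+o_a-o_b+e_c+y+1)}{\operatorname{H}(\mu+y)\operatorname{H}(\mu+y+1)}. \end{align*}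
   Context: Work on the triangular lattice drawn with horizontal lattice lines. A lozenge is the union of two unit triangles sharing an edge; a (lozenge) tiling of a region is a covering by lozenges without gaps or overlaps; $\operatorname{M}(R)$ denotes the number of tilings of $R$. Vertical distances are measured in rows (the height of a unit triangle); ''the horizontal lattice line at level $t$ above a point $P$'' is the horizontal lattice line $t$ rows above $P$. Lattice hexagons have all angles $120^\circ$ and their side-lengths are listed clockwise starting from the horizontal top side: north, northeast, southeast, south, southwest, northwest. The east vertex is the common vertex of the northeast and southeast sides; the west vertex is the common vertex of the southwest and northwest sides. Hyperfactorial: $\operatorname{H}(n)=0!\,1!\cdots(n-1)!$ for nonnegative integers $n$ ($\operatorname{H}(0)=1$). For a sequence $\mathbf t=(t_1,\dots,t_r)$ of nonnegative integers, $o_t=\sum_{i\text{ odd}}t_i$, $e_t=\sum_{i \text{ even}}t_i$, and $t=t_1+\dots+t_r$; so $a,b,c,o_a,e_a,o_b,\dots$ refer to $\mathbf a,\mathbf b,\mathbf c$. Dented semihexagon: $s(t_1,\dots,t_r)$ is the number of tilings of the region obtained from the trapezoid with horizontal top side of length $e_t$, horizontal bottom side of length $o_t+e_t$, and two slanted sides of length $o_t$, by removing from its bottom side up-pointing triangles of side-lengths $t_1,t_3,t_5,\dots$ from left to right, the first starting at the left end of the bottom side and consecutive removed triangles separated along the bottom side by distances $t_2,t_4,\dots$. (Equivalently, $s(t_1,\dots,t_{2l-1})=s(t_1,\dots,t_{2l})=\frac{1}{\operatorname{H}(t_1+t_3+\dots+t_{2l-1})}\frac{\prod_{1\le i<j\le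 2l-1,\ j-i\text{ odd}}\operatorname{H}(t_i+\dots+t_j)}{\prod_{1\le i<j\le 2l-1,\ j-i\text{ even}}\operatorname{H}(t_i+\dots+t_j)}$.) Cored hexagon: for nonnegative integers $X,Y,Z,p$, $C_{X,Y,Z}(p)$ is obtained from the hexagon $H$ with side-lengths $X,Y+p,Z,X+p,Y,Z+p$ as follows. Let $H_0$ be the hexagon with side-lengths $X,Y,Z,X,Y,Z$ whose south, southwest and northwest sides lie on the lines of the south, southwest and northwest sides of $H$; let $O$ be the center of symmetry of $H_0$. Remove the up-pointing triangle of side $p$ whose left vertex is: $O$ if $X,Y,Z$ all have the same parity; the point $1/2$ unit west of $O$ if $X$ has parity different from $Y$ and $Z$; the point $1/2$ unit from $O$ in the northwest lattice direction if $Y$ has parity different from $X$ and $Z$; the point $1/2$ unit from $O$ in the southwest lattice direction if $Z$ has parity different from $X$ and $Y$. Fern: a string of lattice triangles of side-lengths $t_1,\dots,t_r$ (side $0$ allowed) with alternating orientations, all having a horizontal side on a common horizontal lattice line $\ell$ (up-pointing ones above $\ell$, down-pointing ones below), consecutive triangles meeting at a vertex on $\ell$; it occupies a segment of $\ell$ of length $t_1+\dots+t_r$. Removing a fern means removing the union of its triangles. The region $R^{\nwarrow}_{x,y,z}(\mathbf a;\mathbf c;\mathbf b)$ (for $x\equiv z \pmod 2$): let $H$ be the hexagon with side-lengths $x+o_a+e_b+e_c$, $2y+z+e_a+o_b+o_c+|a-b|+1$, $z+o_a+e_b+e_c$, $x+e_a+o_b+o_c$, $2y+z+o_a+e_b+e_c+|a-b|+1$,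 $z+e_a+o_b+o_c$. Let $\ell$ be the horizontal lattice line at level $y+1$ above the east vertex of $H$ if $a<b$, and at level $y+(a-b)+1$ if $a\ge b$; $\ell\cap H$ is a segment of length $x+z+a+b+c$. Remove from $H$ three ferns along $\ell$: the left fern with side-lengths $a_1,\dots,a_m$ from left to right, $a_1$ down-pointing, starting at the left endpoint of $\ell\cap H$; the right fern with side-lengths $b_1,\dots,b_n$ read from right to left, $b_1$ up-pointing, ending at the right endpoint of $\ell\cap H$; and the middle fern with side-lengths $c_1,\dots,c_k$ from left to right, $c_1$ up-pointing, placed so that the distance along $\ell$ from the right end of the left fern to the left end of the middle fern and the distance from the right end of the middle fern to the left end of the right fern are both $\frac{x+z}{2}$. *)

(* Defs.v *)
From mathcomp Require Import all_boot all_order all_algebra finmap.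

Set Implicit Arguments.
Unset Strict Implicit.
Unset Printing Implicit Defensive.

Import Order.TTheory GRing.Theory Num.Theory.
Local Open Scope fset_scope.
Local Open Scope ring_scope.

(* The lattice point (i, j) is i * e + j * f, where e is the unit vector
   pointing east and f the unit vector at 60 degrees counterclockwise from e.
   Thus j is the row, the lattice lines are i = const, j = const and
   i + j = const, and the northwest and southwest lattice directions are
   (-1, 1) and (0, -1). *)
Definition point : Type := (int * int)%type.

(* (P, true) is the up-pointing unit triangle P, P + e, P + f; (P, false) is
   the down-pointing unit triangle P + e, P + f, P + e + f. *)
Definition triangle : Type := (int * int * bool)%type.

Definition vertices (t : triangle) : seq point :=
  let: (i, j, up) := t in
  if up then [:: (i, j); (i + 1, j); (i, j + 1)]
  else [:: (i + 1, j); (i, j + 1); (i + 1, j + 1)].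

Definition share_edge (t u : triangle) : bool :=
  (t != u) && (count (mem (vertices u)) (vertices t) == 2).

Definition region : Type := {fset triangle}.

Definition lozenges (R : region) : {fset {fset triangle}} :=
  [fset [fset t; u] | t in R, u in R & share_edge t u].

Definition tilings (R : region) : {fset {fset {fset triangle}}} :=
  [fset T in fpowerset (lozenges R) | trivIfset T & fcover T == R].

Definition M (R : region) : nat := #|` tilings R|.

Definition in_polygon (i0 i1 j0 j1 k0 k1 : int) (P : point) : bool :=
  [&& i0 <= P.1 <= i1, j0 <= P.2 <= j1 & k0 <= P.1 + P.2 <= k1].

Definition int_range (m n : int) : seq int :=
  [seq m + k%:Z | k <- iota 0 (absz (n - m)%R).+1].

(* The enumerated box loses nothing: the minimal coordinates of the vertices
   of (i, j, up) are i and j, for both orientations. *)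
Definition polygon (i0 i1 j0 j1 k0 k1 : int) : region :=
  [fset t in [seq (P, up) | P <- [seq (i, j) | i <- int_range i0 i1,
                                               j <- int_range j0 j1],
                            up <- [:: true; false]]
     | all (in_polygon i0 i1 j0 j1 k0 k1) (vertices t)].

(* Up-pointing triangle of side p with left vertex (i, j). *)
Definition up_triangle (i j : int) (p : nat) : region :=
  polygon i (i + p%:Z) j (j + p%:Z) (i + j) (i + j + p%:Z).

(* Down-pointing triangle of side p with top left vertex (i, j). *)
Definition down_triangle (i j : int) (p : nat) : region :=
  polygon i (i + p%:Z) (j - p%:Z) j (i + j) (i + j + p%:Z).

(* Hexagon with west vertex (0, 0). Its other vertices, in clockwise order,
   are (0, nw), (n, nw), (n + ne, nw - ne), (n + ne, nw - ne - se) and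
   (n + ne - s, nw - ne - se) = (sw, - sw). *)
Definition hexagon (n ne se s sw nw : int) : region :=
  polygon 0 (n + ne) (- sw) nw (n + nw - se - s) (n + nw).

(* Fern with leftmost point (i, j), on the lattice line of row j; t lists its
   side-lengths from left to right, and up tells whether the first triangle is
   up-pointing. *)
Fixpoint fern (up : bool) (i j : int) (t : seq nat) : region :=
  if t is p :: t' then
    (if up then up_triangle i j p else down_triangle i j p)
      `|` fern (~~ up) (i + p%:Z) j t'
  else fset0.

(* The sequences t_1, ..., t_r are indexed from 1, but nth counts from 0. *)
Definition osum (t : seq nat) : nat := (\sum_(i < size t | ~~ odd i) nth 0 t i)%N.
Definition esum (t : seq nat) : nat := (\sum_(i < size t | odd i) nth 0 t i)%N.

(* The bottom left corner of the trapezoid is (0, 0). *)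
Definition dented_semihexagon (t : seq nat) : region :=
  polygon 0 (osum t + esum t)%N%:Z 0 (osum t)%:Z 0 (osum t + esum t)%N%:Z
    `\` \bigcup_(i <- iota 0 (size t) | ~~ odd i)
          up_triangle (sumn (take i t))%:Z 0 (nth 0%N t i).

Definition s (t : seq nat) : nat := M (dented_semihexagon t).

(* Twice the coordinates of the left vertex of the removed triangle. The
   auxiliary hexagon with sides X, Y, Z, X, Y, Z has west vertex (0, 0) and
   east vertex (X + Y, Z - Y), so that the latter is twice its center. *)
Definition core2 (X Y Z : nat) : point :=
  let O2 : point := (X%:Z + Y%:Z, Z%:Z - Y%:Z) in
  if odd Y == odd Z then
    if odd X == odd Y then O2 else (O2.1 - 1, O2.2)
  else if odd X == odd Z then (O2.1 - 1, O2.2 + 1)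
  else (O2.1, O2.2 - 1).

Definition cored_hexagon (X Y Z p : nat) : region :=
  hexagon X%:Z (Y + p)%N%:Z Z%:Z (X + p)%N%:Z Y%:Z (Z + p)%N%:Z
    `\` up_triangle ((core2 X Y Z).1 %/ 2)%Z ((core2 X Y Z).2 %/ 2)%Z p.

(* The row j contains the horizontal line along which the ferns are removed;
   the east vertex of the hexagon is in row nw - ne, and l and r are the
   abscissas of the endpoints of the intersection of the line and the
   hexagon. *)
Definition region_nw (x : nat) (y : int) (z : nat) (a c b : seq nat) : region :=
  let d : int := `|(sumn a)%:Z - (sumn b)%:Z| in
  let up := (esum a + osum b + osum c)%N%:Z in
  let down := (osum a + esum b + esum c)%N%:Z in
  let n := x%:Z + down in
  let ne := 2 * y + z%:Z + up + d + 1 in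
  let se := z%:Z + down in
  let s := x%:Z + up in
  let sw := 2 * y + z%:Z + down + d + 1 in
  let nw := z%:Z + up in
  let level :=
    if (sumn a < sumn b)%N then y + 1
    else y + ((sumn a)%:Z - (sumn b)%:Z) + 1 in
  let j := nw - ne + level in
  let l := Num.max 0 (- j) in
  let r := Num.min (n + ne) (n + nw - j) in
  let h := ((x + z)./2)%N in
  hexagon n ne se s sw nw
    `\` fern false l j a
    `\` fern true (l + (sumn a + h)%N%:Z) j c
    `\` fern (odd (size b)) (r - (sumn b)%:Z) j (rev b).

(* Used for n >= 0 only. *)
Definition hyperfactorial (n : int) : rat := (\prod_(i < absz n) i`!)%N%:R.

(* Main.v *)
Require Import Defs.
From mathcomp Require Import all_boot all_order all_algebra finmap.
From mathcomp Require Import zify ring.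
Import Order.TTheory GRing.Theory Num.Theory.
Set Implicit Arguments.
Unset Strict Implicit.
Unset Printing Implicit Defensive.
Local Open Scope ring_scope.

(** Cut the region along the line of the ferns and sum over the set S of
    positions of the z vertical lozenges that cross it. Each half is, up to
    forced lozenges, a trapezoid with unit dents on its long base, and the
    number of its tilings is the Vandermonde product of the dent positions
    divided by a hyperfactorial (Cohn, Larsen and Propp). Hence the summand is
    a constant times the square of the Vandermonde product of S times the
    product of all distances from S to the other dents of the two halves.
    Every fern cell is a dent of exactly one half, so the latter product only
    depends on the total lengths of the ferns; it is the same for the region
    and for the cored hexagon, and the sum over S cancels in the quotient of
    the two numbers of tilings. *)

(** Why the parameter 2y+z+2μ+1: let the cut lie L = y+b-ν rows below the west vertex and Rt =
    y+a+1-ν rows above the east vertex. Completing each half to a trapezoid adds a corner triangle,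
    of side L on the left above the cut and of side Rt on the right below it, and each corner counts
    as further dents. The first gap then starts at A = L+a = μ+y, and Rt+b = A+1 cells lie to the
    right of the second one. A hexagon with the same gaps and no side ferns has its west vertex A
    rows above the line and its east vertex A+1 rows below it, which gives the second parameter
    2A+z+1 of the cored hexagon. The hyperfactorials of the formula have three sources: the row
    numbers of the four trapezoids, the denominators in the two factors [s], and the Vandermonde
    product of the blocks of lengths A and c at distance h, which are the upper dents of the cored
    hexagon. *)

(** * Exact covers of a finite set by tiles from a list *)

Section MatchingCount.
Local Open Scope fset_scope.
Local Open Scope nat_scope.
Variable K : choiceType.
Implicit Types (E : seq {fset K}) (l R : {fset K}).

(** Deciding one tile at a time turns cutting and forcing into inductions on the list. Tiles that do
    not fit into [R] are harmless, so one list serves all subregions. *)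
Fixpoint mcount E R : nat :=
  if E is l :: E' then (if l `<=` R then mcount E' (R `\` l) else 0) + mcount E' R
  else R == fset0.

Lemma fcoverU1 l (T : {fset {fset K}}) : fcover (l |` T) = l `|` fcover T.
Proof.
apply/fsetP => x; apply/idP/idP.
  case/bigfcupP => B; rewrite !inE => /andP[/orP[/eqP->|BT] _] xB.
    by rewrite xB.
  by apply/orP; right; apply/bigfcupP; exists B; rewrite ?BT.
rewrite inE => /orP[xl|/bigfcupP[B]].
  by apply/bigfcupP; exists l => //; rewrite !inE eqxx.
by rewrite andbT => BT xB; apply/bigfcupP; exists B => //; rewrite !inE BT orbT.
Qed.

Lemma trivIfsetU1 l (T : {fset {fset K}}) : l \notin T ->
  trivIfset (l |` T) = trivIfset T && [disjoint l & fcover T]%fset.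
Proof.
move=> lT; apply/trivIfsetP/andP => [H|[/trivIfsetP H D]].
  split; first by apply/trivIfsetP => A B AT BT; apply: H; rewrite !inE ?AT ?BT orbT.
  apply/fdisjointP => x xl; apply/negP => /bigfcupP[B]; rewrite andbT => BT xB.
  have /fdisjointP/(_ x xl) : [disjoint l & B]%fset.
    by apply: H; rewrite ?inE ?eqxx ?BT ?orbT //; apply: contraNneq lT => ->.
  by rewrite xB.
have DB B : B \in T -> [disjoint l & B]%fset.
  move=> BT; apply/fdisjointP => x xl; apply: contraTN xl => xB.
  apply: contraTN D => xl; apply/fdisjointP => /(_ x xl)/negP; apply.
  by apply/bigfcupP; exists B; rewrite ?BT.
move=> A B; rewrite !inE => /orP[/eqP->|AT] /orP[/eqP->|BT] nAB.
- by rewrite eqxx in nAB.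
- exact: DB.
- by rewrite fdisjoint_sym; exact: DB.
- exact: H.
Qed.

(** The right side ignores the order of [E]; this is what later allows chosen tiles to be moved to
    the front of the list. *)
Lemma mcountE E R : uniq E -> fset0 \notin E ->
  mcount E R =
  #|` [fset T in fpowerset [fset l in E] | trivIfset T & fcover T == R]|.
Proof.
elim: E R => [|l E IH] R /=.
  move=> _ _; rewrite (_ : [fset T in _ | _] = if R == fset0 then [fset fset0] else fset0).
    by case: (R == fset0); rewrite ?cardfs1 ?cardfs0.
  apply/fsetP => T; rewrite !inE /= fpowersetE.
  rewrite (_ : [fset l in [::]] = fset0) ?fsubset0; last by apply/fsetP => x; rewrite !inE.
  case: (T =P fset0) => [->|nT] /=; last by case: (R == _); rewrite !inE //; apply/esym/eqP.
  rewrite (_ : trivIfset fset0); last by apply/trivIfsetP => A B; rewrite inE.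
  rewrite /fcover big_seq_fset0 /= eq_sym.
  by case: (R == _); rewrite !inE ?eqxx.
move=> /andP[lE uE]; rewrite inE negb_or eq_sym => /andP[l0 E0].
rewrite !IH //.
set A := [fset T in fpowerset [fset x in l :: E] | _].
pose B R' := [fset T in fpowerset [fset x in E] | trivIfset T & fcover T == R'].
have mB R' T : T \in B R' = [&& T `<=` [fset x in E], trivIfset T & fcover T == R'].
  by rewrite !inE /= fpowersetE.
have lB R' T : T \in B R' -> l \notin T.
  rewrite mB => /and3P[/fsubsetP s _ _]; apply: contra lE => /s.
  by rewrite !inE.
(* Sort the covers by whether they use [l]; those that do are covers of the rest of [R] with [l]
   added. *)
have -> : A = (if l `<=` R then [fset l |` T | T in B (R `\` l)] else fset0) `|` B R.
  apply/fsetP => T; rewrite in_fsetU mB !inE /= fpowersetE.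
  apply/idP/orP.
    case/and3P => /fsubsetP sT tT /eqP cT.
    have [lT|lT] := boolP (l \in T); last first.
      right; apply/and3P; split; rewrite ?cT //.
      apply/fsubsetP => x xT; have := sT _ xT; rewrite !inE /=.
      by case/orP => // /eqP xl; rewrite -xl xT in lT.
    left; have lR : l `<=` R.
      by apply/fsubsetP => x xl; rewrite -cT; apply/bigfcupP; exists l; rewrite ?lT.
    rewrite lR; apply/imfsetP; exists (T `\ l); last by rewrite fsetD1K.
    have lD : l \notin T `\ l by rewrite !inE eqxx.
    move: tT cT; rewrite -{1 2}(fsetD1K lT) trivIfsetU1 // fcoverU1 => /andP[t1 d1] c1.
    rewrite /= mB t1 /=; apply/andP; split.
      by apply/fsubsetP => x; rewrite !inE /= => /andP[nx /sT]; rewrite !inE /= (negPf nx).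
    rewrite -c1; apply/eqP/fsetP => x; rewrite !inE.
    case: (boolP (x \in l)) => //= xl.
    by apply/negbTE; exact: (fdisjointP d1).
  case.
    case: ifP => // lR /imfsetP[T' /= T'B ->]; have lT := lB _ _ T'B.
    move: T'B; rewrite mB => /and3P[/fsubsetP s1 t1 /eqP c1].
    rewrite trivIfsetU1 // fcoverU1 t1 c1.
    apply/and3P; split.
    - apply/fsubsetP => x; rewrite !inE /= => /orP[->//|/s1]; rewrite !inE => ->.
      by rewrite orbT.
    - by apply/fdisjointP => x xl; rewrite inE xl.
    - apply/eqP/fsetP => x; rewrite !inE.
      by case: (boolP (x \in l)) => //= /(fsubsetP lR) ->.
  case/and3P => /fsubsetP s -> ->; rewrite !andbT.
  by apply/fsubsetP => x /s; rewrite !inE /= => ->; rewrite orbT.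
rewrite cardfsU (_ : _ `&` _ = fset0) ?cardfs0 ?subn0.
  case: ifP => // lR; congr (_ + _).
  rewrite [RHS]card_in_imfset //= => T T' TB T'B eqT.
  rewrite -(fsetU1K (lB _ _ TB)) -(fsetU1K (lB _ _ T'B)) eqT //.
apply/fsetP => T; rewrite in_fsetI in_fset0; apply/negP => /andP[+ /lB].
by case: ifP => // lR /imfsetP[T' _ ->]; rewrite !inE eqxx.
Qed.

Lemma mcount_filter (Q : pred {fset K}) E R :
  (forall l, l `<=` R -> Q l) -> mcount E R = mcount (filter Q E) R.
Proof.
elim: E R => //= l E IH R HQ; rewrite [X in _ + X]IH //.
case: ifP => lR; last by case: ifP => //= _; rewrite lR.
rewrite HQ //= lR; congr (_ + _); apply: IH => l' l'R.
exact: HQ (fsubset_trans l'R (fsubsetDl _ _)).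
Qed.

Lemma mcount_eq E E' R : uniq E -> uniq E' -> fset0 \notin E -> fset0 \notin E' ->
  (forall l, l `<=` R -> (l \in E) = (l \in E')) -> mcount E R = mcount E' R.
Proof.
move=> uE uE' nE nE' H; pose Q := fun l => l `<=` R.
rewrite (@mcount_filter Q) // [RHS](@mcount_filter Q) // !mcountE ?filter_uniq //;
  try by rewrite mem_filter negb_and; apply/orP; right.
congr (#|` _|); apply/fsetP => T; rewrite !inE /= !fpowersetE.
congr ((T `<=` _) && _); apply/fsetP => l; rewrite !inE /=.
by rewrite !mem_filter /Q; case: (boolP (l `<=` R)) => //= /H.
Qed.

(** No tile straddles the two parts, so a cover is a pair of independent covers. *)
Lemma mcount_split E R (P : pred K) : fset0 \notin E ->
  (forall l, l \in E -> {in l, forall x, P x} \/ {in l, forall x, ~~ P x}) ->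
  mcount E R = mcount E [fset x in R | P x] * mcount E [fset x in R | ~~ P x].
Proof.
elim: E R => [|l E IH] R /=.
  move=> _ _; rewrite mulnb; congr nat_of_bool; apply/idP/andP.
    by move/eqP->; split; apply/eqP/fsetP => x; rewrite !inE.
  case=> /eqP/fsetP h1 /eqP/fsetP h2; apply/eqP/fsetP => x.
  by have := h1 x; have := h2 x; rewrite !inE /=; case: (x \in R); case: (P x).
rewrite inE negb_or eq_sym => /andP[l0 nE] H.
have {}IH R' := IH R' nE (fun l' h => H l' (mem_behead (s := l :: E) h)).
have [x xl] : exists x, x \in l by exact/fset0Pn.
have sub (Q : pred K) : {in l, forall x, Q x} -> l `<=` [fset x in R | Q x] = (l `<=` R).
  move=> HQ; apply/fsubsetP/fsubsetP => s y yl; first by have := s _ yl; rewrite !inE => /andP[].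
  by rewrite !inE /= s // HQ.
have nsub (Q : pred K) : {in l, forall x, ~~ Q x} -> l `<=` [fset x in R | Q x] = false.
  move=> HQ; apply/negP => /fsubsetP/(_ _ xl); rewrite !inE /=.
  by rewrite (negPf (HQ _ xl)) andbF.
have DQ (Q : pred K) : [fset x in R `\` l | Q x] = [fset x in R | Q x] `\` l.
  by apply/fsetP => y; rewrite !inE /= andbA.
have nDQ (Q : pred K) : {in l, forall x, ~~ Q x} ->
    [fset x in R `\` l | Q x] = [fset x in R | Q x].
  move=> HQ; apply/fsetP => y; rewrite !inE /=.
  by case: (boolP (y \in l)) => //= /HQ /negPf ->; rewrite andbF.
case: (H l (mem_head _ _)) => Hl.
  have Hl' : {in l, forall x, ~~ ~~ P x} by move=> y yl; rewrite negbK Hl.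
  rewrite (sub _ Hl) (nsub _ Hl') add0n mulnDl -IH; congr (_ + _).
  by case: ifP => // _; rewrite IH (nDQ _ Hl') DQ.
rewrite (sub _ Hl) (nsub _ Hl) add0n mulnDr -IH; congr (_ + _).
by case: ifP => // _; rewrite ?muln0 // IH (nDQ _ Hl) DQ.
Qed.

Fixpoint sublists (T : Type) (s : seq T) : seq (seq T) :=
  if s is x :: s' then map (cons x) (sublists s') ++ sublists s' else [:: [::]].

Lemma sublists_subseq (T : eqType) (s t : seq T) : t \in sublists s -> subseq t s.
Proof.
elim: s t => [|x s IH] t /=; first by rewrite inE => /eqP->.
rewrite mem_cat => /orP[/mapP[t' /IH h ->]|/IH h]; first by rewrite /= eqxx.
exact: subseq_trans h (subseq_cons s x).
Qed.

(** [S] records the tiles of the first block that are used. They are pairwise disjoint, so removing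
    some does not affect whether another one fits. *)
Lemma mcount_cat (I : choiceType) (G : seq I) (f : I -> {fset K}) E R :
  {in G &, forall i j, i != j -> [disjoint f i & f j]%fset} -> uniq G ->
  mcount (map f G ++ E) R =
  \sum_(S <- sublists G)
     if all (fun i => f i `<=` R) S then mcount E (R `\` \bigcup_(i <- S) f i) else 0.
Proof.
elim: G R => [|i G IH] R /=; first by rewrite big_seq1 /= big_nil fsetD0.
move=> D /andP[iG uG].
have D' : {in G &, forall i j, i != j -> [disjoint f i & f j]%fset}.
  by move=> x y xG yG; apply: D; rewrite inE ?xG ?yG orbT.
rewrite big_cat big_map /= !IH //; congr (_ + _).
have [iR|iR] := boolP (f i `<=` R); last by rewrite /= big1.
rewrite [LHS]big_seq [RHS]big_seq; apply: eq_bigr => S /sublists_subseq/mem_subseq sG.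
rewrite big_cons fsetDDl /=.
congr (if _ then _ else _); apply: eq_in_all => j /sG jG.
rewrite fsubsetD; case: (f j `<=` R) => //=.
by apply: D; rewrite ?inE ?jG ?eqxx ?orbT //; apply: contraNneq iG => <-.
Qed.

Lemma mcount_isolated E R x : x \in R ->
  {in E, forall l, l `<=` R -> x \notin l} -> mcount E R = 0.
Proof.
elim: E R => [|l E IH] R /=.
  by move=> xR _; apply/eqP; rewrite eqb0; apply/fset0Pn; exists x.
move=> xR H; rewrite [X in _ + X]IH //; last first.
  by move=> l' h; apply: H; rewrite inE h orbT.
case: ifP => // lR; rewrite IH // => [|l' h h']; first by rewrite inE xR H ?inE ?eqxx.
by apply: H; rewrite ?inE ?h ?orbT //; exact: fsubset_trans h' (fsubsetDl _ _).
Qed.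

End MatchingCount.

Lemma mcount_imfset (K K' : choiceType) (f : K -> K') (E : seq {fset K})
    (R : {fset K}) : injective f ->
  mcount [seq (f @` l)%fset | l : {fset K} <- E] (f @` R)%fset = mcount E R.
Proof.
move=> fI; elim: E R => /= [|l E IH] R.
  congr nat_of_bool; apply/eqP/eqP => [|->]; last by rewrite imfset0.
  move=> H; apply/fsetP => x; rewrite inE; apply/negP => xR.
  by have := in_imfset imfset_key f xR; rewrite H.
rewrite IH -IH; congr (_ + _)%N.
have -> : ((f @` l `<=` f @` R) = (l `<=` R))%fset.
  apply/fsubsetP/fsubsetP => s x; last by case/imfsetP => y /s yR ->; apply: in_imfset.
  by move=> /(in_imfset imfset_key f)/s /imfsetP[y /= yR /fI ->].
case: ifP => // _; rewrite -IH; congr (mcount _ _); apply/fsetP => x; rewrite inE.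
apply/andP/imfsetP => [[nl /imfsetP[y /= yR xy]]|[y /=]].
  exists y => //=; rewrite inE yR andbT; apply: contra nl; rewrite xy; exact: in_imfset.
rewrite inE => /andP[yl yR] ->; split; last exact: in_imfset.
by apply: contra yl => /imfsetP[y' /= ? /fI ->].
Qed.

(** * Lozenge tilings: forced lozenges, symmetries and horizontal cuts *)

Section Lozenges.
Local Open Scope fset_scope.
Local Open Scope ring_scope.
Implicit Types (R : region) (t u v : triangle) (l : {fset triangle}).

Lemma share_edgeE (i j : int) b (i' j' : int) b' :
  share_edge (i, j, b) (i', j', b') =
  (b != b') &&
  (if b then (j' == j) && ((i' == i) || (i' == i - 1)) || (i' == i) && (j' == j - 1)
   else (j' == j) && ((i' == i) || (i' == i + 1)) || (i' == i) && (j' == j + 1)).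
Proof.
(* Only the differences [p] and [q] matter, and the vertices compare them with -1, 0 and 1 only, so
   finitely many cases remain. *)
have [p ->] : exists p, i' = i + p by exists (i' - i); lia.
have [q ->] : exists q, j' = j + q by exists (j' - j); lia.
have e0 (x : int) : (x == x + p) = (p == 0) by lia.
have e1 (x : int) : (x + 1 == x + p) = (p == 1) by lia.
have e2 (x : int) : (x == x + p + 1) = (p == -1) by lia.
have e3 (x : int) : (x + 1 == x + p + 1) = (p == 0) by lia.
have e4 (x : int) : (x + p == x) = (p == 0) by lia.
have e5 (x : int) : (x + p == x + 1) = (p == 1) by lia.
have e6 (x : int) : (x + p == x - 1) = (p == -1) by lia.
have f0 (x : int) : (x == x + q) = (q == 0) by lia.
have f1 (x : int) : (x + 1 == x + q) = (q == 1) by lia.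
have f2 (x : int) : (x == x + q + 1) = (q == -1) by lia.
have f3 (x : int) : (x + 1 == x + q + 1) = (q == 0) by lia.
have f4 (x : int) : (x + q == x) = (q == 0) by lia.
have f5 (x : int) : (x + q == x + 1) = (q == 1) by lia.
have f6 (x : int) : (x + q == x - 1) = (q == -1) by lia.
rewrite /share_edge.
case: b b' => [] [] /=; rewrite !inE !xpair_eqE ?(e0,e1,e2,e3,e4,e5,e6) ?(f0,f1,f2,f3,f4,f5,f6).
all: case: (p =P 0) => [->|?]; try (case: (p =P 1) => [->|?]); try case: (p == -1).
all: case: (q =P 0) => [->|?]; try (case: (q =P 1) => [->|?]); try case: (q == -1).
all: by [].
Qed.

Lemma share_edge_sym t u : share_edge t u = share_edge u t.
Proof.
case: t u => [[i j] b] [[i' j'] b']; rewrite !share_edgeE.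
by case: b b' => [] [] //=; lia.
Qed.

Definition is_lozenge l := exists t u, share_edge t u /\ l = [fset t; u].

Lemma in_lozenges R l : reflect (l `<=` R /\ is_lozenge l) (l \in lozenges R).
Proof.
apply: (iffP (imfset2P _ _ _ _ _)) => /=.
  case=> t tR [u]; rewrite !inE => /andP[uR tu] ->; split; last by exists t, u.
  by apply/fsubsetP => v; rewrite !inE => /orP[] /eqP->.
case=> /fsubsetP lR [t [u [tu def_l]]]; exists t; first by apply: lR; rewrite def_l !inE eqxx.
by exists u => //; rewrite !inE tu andbT lR // def_l !inE eqxx orbT.
Qed.

Lemma lozenges0 R : fset0 \notin lozenges R.
Proof.
apply/in_lozenges => -[_ [t [u [_ /fsetP/(_ t)]]]].
by rewrite !inE eqxx.
Qed.

(** Only the tiles inside [R] have to be right, so the lozenges of a large region also count the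
    tilings of its subregions. *)
Lemma M_mcount (E : seq {fset triangle}) R : uniq E -> fset0 \notin E ->
  (forall l, l `<=` R -> reflect (is_lozenge l) (l \in E)) -> M R = mcount E R.
Proof.
move=> uE nE HE; rewrite (@mcount_eq _ E (lozenges R)) ?fset_uniq ?lozenges0 //.
  rewrite mcountE ?fset_uniq ?lozenges0 // /M /tilings.
  by rewrite (_ : [fset l in _] = lozenges R) //; apply/fsetP => l; rewrite !inE.
move=> l lR; apply/(HE _ lR)/in_lozenges => [|[]//].
by split.
Qed.

Lemma M_mcount_sub R R' : R' `<=` R -> M R' = mcount (lozenges R) R'.
Proof.
move=> sR; apply: M_mcount; rewrite ?fset_uniq ?lozenges0 // => l lR.
apply: (iffP (in_lozenges _ _)) => [[]//|ll]; split=> //; exact: fsubset_trans lR sR.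
Qed.

Lemma M0 : M fset0 = 1%N.
Proof.
rewrite (@M_mcount [::]) //= => l; rewrite fsubset0 => /eqP->; constructor.
by case=> t [u [_ /fsetP/(_ t)]]; rewrite !inE eqxx.
Qed.

Lemma M_isolated R t : t \in R -> {in R, forall u, ~~ share_edge t u} -> M R = 0%N.
Proof.
move=> tR H; rewrite (M_mcount_sub (fsubset_refl R)) (mcount_isolated tR) // => l.
case/in_lozenges => lR [v [u [vu def_l]]] _; rewrite def_l !inE.
have vR : v \in R by apply: (fsubsetP lR); rewrite def_l !inE eqxx.
have uR : u \in R by apply: (fsubsetP lR); rewrite def_l !inE eqxx orbT.
apply/norP; split; apply: contraTneq vu => <-; last by rewrite share_edge_sym H.
by rewrite H.
Qed.

Lemma M_forced R t u : t \in R -> u \in R -> share_edge t u ->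
  {in R, forall v, share_edge t v -> v = u} -> M R = M (R `\` [fset t; u]).
Proof.
move=> tR uR tu H; pose E := lozenges R `\ [fset t; u].
have lE : [fset t; u] \in lozenges R.
  apply/in_lozenges; split; last by exists t, u.
  by apply/fsubsetP => v; rewrite !inE => /orP[] /eqP->.
have nE : fset0 \notin E by apply: contra (lozenges0 R); rewrite inE => /andP[].
rewrite (M_mcount_sub (fsubset_refl R)).
rewrite (@mcount_eq _ _ ([fset t; u] :: E)) /= ?fset_uniq ?lozenges0 //; first last.
- move=> l lR; rewrite inE in_fsetD1; case: eqP => // ->; exact: lE.
- by rewrite inE (negPf nE) orbF; apply: contra (lozenges0 R) => /eqP->.
- by rewrite andbT in_fsetD1 eqxx.
(* With the forced lozenge at the head of the list, the branch that rejects it contributes 0: no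
   other lozenge covers [t]. *)
rewrite [X in (_ + X)%N](mcount_isolated tR) ?addn0; last first.
  move=> l; rewrite in_fsetD1 => /andP[nl /in_lozenges[lR [v [w [vw def_l]]]]] _.
  have vR : v \in R by apply: (fsubsetP lR); rewrite def_l !inE eqxx.
  have wR : w \in R by apply: (fsubsetP lR); rewrite def_l !inE eqxx orbT.
  apply: contra nl; rewrite def_l !inE => /orP[] /eqP tE; subst t.
    by rewrite (H w).
  by rewrite (H v) ?[share_edge w v]share_edge_sym // fsetUC.
have -> : [fset t; u] `<=` R by case/in_lozenges: lE.
apply/esym/M_mcount => //; first exact: fset_uniq.
move=> l lR; apply: (iffP idP).
  by rewrite in_fsetD1 => /andP[_ /in_lozenges[]].
move=> ll; rewrite in_fsetD1; apply/andP; split; last first.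
  by apply/in_lozenges; split=> //; exact: fsubset_trans lR (fsubsetDl _ _).
apply: contraTneq lR => ->; apply/negP => /fsubsetP/(_ t).
by rewrite !inE eqxx => /(_ isT).
Qed.

Lemma M_imfset (f : triangle -> triangle) R : injective f ->
  (forall t u, share_edge (f t) (f u) = share_edge t u) -> M (f @` R) = M R.
Proof.
move=> fI fS; rewrite (M_mcount_sub (fsubset_refl R)) -(mcount_imfset _ _ fI).
have lE t u : [fset f x | x in [fset t; u]] = [fset f t; f u].
  apply/fsetP => x; rewrite !inE; apply/imfsetP/orP => /= [[y]|].
    by rewrite !inE => /orP[] /eqP-> ->; [left|right].
  by case=> /eqP->; [exists t|exists u]; rewrite // !inE eqxx ?orbT.
apply: M_mcount.
- rewrite map_inj_uniq ?fset_uniq // => l l' /fsetP E; apply/fsetP => x.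
  apply/idP/idP => xl.
    by have := in_imfset imfset_key f xl; rewrite E => /imfsetP[y /= yl /fI->].
  by have := in_imfset imfset_key f xl; rewrite -E => /imfsetP[y /= yl /fI->].
- apply/mapP => -[l /in_lozenges[_ [t [u [_ ->]]]]]; rewrite lE => /fsetP/(_ (f t)).
  by rewrite !inE eqxx.
move=> l lR; apply: (iffP mapP) => [[l' /in_lozenges[_ [t [u [tu ->]]]] ->]|].
  by exists (f t), (f u); rewrite fS lE.
case=> t' [u' [tu def_l]].
have /(fsubsetP lR)/imfsetP[t /= tR tE] : t' \in l by rewrite def_l !inE eqxx.
have /(fsubsetP lR)/imfsetP[u /= uR uE] : u' \in l by rewrite def_l !inE eqxx orbT.
exists [fset t; u]; last by rewrite lE def_l tE uE.
apply/in_lozenges; split; last by exists t, u; rewrite -fS -tE -uE.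
by apply/fsubsetP => v; rewrite !inE => /orP[] /eqP->.
Qed.

Definition row_cells (j : int) (up : bool) (S : seq nat) : region :=
  [fset (i%:Z, j, up) | i in S].

Lemma in_row_cells (j : int) up S (i j' : int) up' :
  ((i, j', up') \in row_cells j up S) =
  [&& j' == j, up' == up, 0 <= i & absz i \in S].
Proof.
apply/imfsetP/and4P => /= [[k kS [-> -> ->]]|[/eqP-> /eqP-> i0 iS]].
  by split.
by exists (absz i) => //; rewrite gez0_abs.
Qed.

Definition above (j : int) R : region := [fset t in R | j <= t.1.2].
Definition below (j : int) R : region := [fset t in R | ~~ (j <= t.1.2)].

Lemma in_above j R t : (t \in above j R) = (t \in R) && (j <= t.1.2).
Proof. by rewrite !inE. Qed.

Lemma in_below j R t : (t \in below j R) = (t \in R) && ~~ (j <= t.1.2).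
Proof. by rewrite !inE. Qed.

(** A lozenge crosses the line of row [j] only by joining an up-pointing cell of row [j] to the
    down-pointing cell just below it. [G] lists the candidate positions and [S] those occupied; what
    remains on either side is tiled independently. *)
Lemma M_cut R (j : int) (G : seq nat) : uniq G ->
  (forall i, (i, j, true) \in R -> (i, j - 1, false) \in R -> exists2 k, k \in G & i = k%:Z) ->
  M R = (\sum_(S <- sublists G)
    if all (fun k => ((k%:Z, j, true) \in R) && ((k%:Z, (j - 1)%R, false) \in R)) S
    then M (above j R `\` row_cells j true S) * M (below j R `\` row_cells (j - 1)%R false S)
    else 0)%N.
Proof.
move=> uG HG; pose f (k : nat) : {fset triangle} := [fset (k%:Z, j, true); (k%:Z, j - 1, false)].
have f_inj : injective f.
  move=> k k' /fsetP/(_ (k%:Z, j, true)); rewrite !inE eqxx /= !xpair_eqE /=.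
  by rewrite andbF orbF andbT eqxx andbT => /esym/eqP [].
pose E := [seq l : {fset triangle} <- lozenges R | l \notin map f G].
have nE : fset0 \notin E by rewrite mem_filter (negPf (lozenges0 R)) andbF.
have fl k : is_lozenge (f k).
  by exists (k%:Z, j, true), (k%:Z, j - 1, false); rewrite share_edgeE !eqxx orbT.
(* The crossing lozenges are put first, so that expanding this block of the list yields the sum over
   [S]. *)
rewrite (M_mcount_sub (fsubset_refl R)) (@mcount_eq _ _ (map f G ++ E)); first last.
- move=> l lR; rewrite mem_cat mem_filter; case: (boolP (l \in map f G)) => //=.
  by case/mapP => k kG lE; apply/in_lozenges; split=> //; rewrite lE; exact: fl.
- rewrite mem_cat (negPf nE) orbF; apply/mapP => -[k _ /fsetP/(_ (k%:Z, j, true))].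
  by rewrite !inE eqxx.
- exact: lozenges0.
- rewrite cat_uniq map_inj_uniq // uG filter_uniq ?fset_uniq // andbT /=.
  by apply/hasPn => l; rewrite mem_filter => /andP[].
- exact: fset_uniq.
rewrite mcount_cat //; last first.
  move=> k k' _ _ nk; apply/fdisjointP => x; rewrite !inE => /orP[] /eqP->;
  rewrite !xpair_eqE /= ?andbF ?andbT ?orbF; lia.
apply: eq_bigr => S _.
have sub k : f k `<=` R = ((k%:Z, j, true) \in R) && ((k%:Z, j - 1, false) \in R).
  apply/fsubsetP/andP => [s|[h1 h2] x]; first by split; apply: s; rewrite !inE eqxx ?orbT.
  by rewrite !inE => /orP[] /eqP->.
rewrite (eq_all sub); case: ifP => // _.
pose P (t : triangle) := j <= t.1.2.
(* All other lozenges stay on one side: two adjacent cells separated by the line form a crossing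
   lozenge, whose position is in [G]. *)
have HE l : l \in E -> {in l, forall x, P x} \/ {in l, forall x, ~~ P x}.
  rewrite mem_filter => /andP[nl /in_lozenges[lR [t [u [tu def_l]]]]].
  suff : P t = P u.
    move=> Ptu; have [Pt|Pt] := boolP (P t); [left|right] => x; rewrite def_l !inE;
    by case/orP => /eqP-> //; rewrite -Ptu.
  have tR : t \in R by apply: (fsubsetP lR); rewrite def_l !inE eqxx.
  have uR : u \in R by apply: (fsubsetP lR); rewrite def_l !inE eqxx orbT.
  wlog tup : t u tu def_l tR uR / t.2.
    move=> W; case: (boolP t.2) => tb; first exact: W.
    apply/esym/W => //; first by rewrite share_edge_sym.
      by rewrite fsetUC.
    by case: t u tu tb {W def_l tR uR} => [[i1 j1] []] [[i2 j2] []]; rewrite ?share_edgeE.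
  case: t u tup tu def_l tR uR => [[i1 j1] []] // [[i2 j2] []] // _;
    rewrite share_edgeE // /P /= => tu def_l tR uR.
  apply/idP/idP => /= h; last by lia.
  case: (lerP j j2) => // h2.
  have /and3P[/eqP e1 /eqP e2 /eqP e3] : [&& j1 == j, i2 == i1 & j2 == j - 1] by lia.
  subst; case: (HG _ tR uR) => k kG ik; case/mapP: nl; exists k => //.
  by rewrite /f -ik.
rewrite (mcount_split _ nE HE).
congr (_ * _)%N.
  have -> : [fset x in R `\` \bigcup_(i <- S) f i | P x] = above j R `\` row_cells j true S.
    apply/fsetP => -[[i j'] b]; rewrite !inE in_row_cells /P /=.
    case: (boolP ((i, j', b) \in R)) => _; rewrite ?andbF //= ?andbT.
    case: (lerP j j') => jj; rewrite ?andbF ?andbT //; congr (~~ _).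
    apply/bigfcupP/and4P => [[k]|].
      rewrite andbT !inE => kS /orP[]/eqP[ei ej eb]; subst; first by split.
      lia.
    case=> /eqP-> /eqP-> i0 iS; exists (absz i); rewrite ?iS //.
    by rewrite !inE gez0_abs ?eqxx.
  apply/esym/M_mcount => //; first by rewrite filter_uniq ?fset_uniq.
  move=> l lR; rewrite mem_filter; apply: (iffP andP) => [[_ /in_lozenges[]]//|ll].
  split; last first.
    apply/in_lozenges; split => //; apply: fsubset_trans lR _.
    by apply/fsubsetP => x; rewrite !inE => /and3P[].
  apply/mapP => -[k _ lE].
  have /(fsubsetP lR) : (k%:Z, j - 1, false) \in l by rewrite lE !inE eqxx orbT.
  by rewrite !inE /=; lia.
have -> : [fset x in R `\` \bigcup_(i <- S) f i | ~~ P x] = below j R `\` row_cells (j - 1) false S.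
  apply/fsetP => -[[i j'] b]; rewrite !inE in_row_cells /P /=.
  case: (boolP ((i, j', b) \in R)) => _; rewrite ?andbF //= ?andbT.
  case: (lerP j j') => jj; rewrite ?andbF ?andbT //; congr (~~ _).
  apply/bigfcupP/and4P => [[k]|].
    rewrite andbT !inE => kS /orP[]/eqP[ei ej eb]; subst; last by split.
    lia.
  case=> /eqP-> /eqP-> i0 iS; exists (absz i); rewrite ?iS //.
  by rewrite !inE gez0_abs ?eqxx ?orbT.
apply/esym/M_mcount => //; first by rewrite filter_uniq ?fset_uniq.
move=> l lR; rewrite mem_filter; apply: (iffP andP) => [[_ /in_lozenges[]]//|ll].
split; last first.
  apply/in_lozenges; split => //; apply: fsubset_trans lR _.
  by apply/fsubsetP => x; rewrite !inE => /and3P[].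
apply/mapP => -[k _ lE].
have /(fsubsetP lR) : (k%:Z, j, true) \in l by rewrite lE !inE eqxx.
by rewrite !inE /=; lia.
Qed.

End Lozenges.

Lemma in_polygonE (i0 i1 j0 j1 k0 k1 i j : int) up :
  ((i, j, up) \in polygon i0 i1 j0 j1 k0 k1) =
  [&& i0 <= i, i + 1 <= i1, j0 <= j, j + 1 <= j1 &
    if up then (k0 <= i + j) && (i + j + 1 <= k1)
    else (k0 <= i + j + 1) && (i + j + 2 <= k1)].
Proof.
have range (m n k : int) : m <= k -> k <= n -> k \in int_range m n.
  move=> mk kn; apply/mapP; exists (absz (k - m)); last by lia.
  by rewrite mem_iota; lia.
rewrite /polygon in_fset [LHS]inE; set X := all _ _.
have -> : X = [&& i0 <= i, i + 1 <= i1, j0 <= j, j + 1 <= j1 &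
    if up then (k0 <= i + j) && (i + j + 1 <= k1)
    else (k0 <= i + j + 1) && (i + j + 2 <= k1)].
  by rewrite /X /in_polygon {X}; case: up => /=; apply/idP/idP; lia.
apply/andb_idl => H; apply/allpairsP; exists ((i, j), up); split => //; last first.
  by case: (up); rewrite !inE.
by apply/allpairsP; exists (i, j); split => //; apply: range => /=; lia.
Qed.

(** * Tilings of a single row and interlacing sequences *)

Section OneRow.
Local Open Scope fset_scope.
Local Open Scope ring_scope.

Definition strip (us ds : seq nat) : region :=
  row_cells 0 true us `|` row_cells 0 false ds.

Definition adjacent_cells (u d : nat) : bool := (u == d) || (u == d.+1).

Lemma path_ltn_mem (x k : nat) s : path ltn x s -> k \in s -> (x < k)%N.
Proof. by move/(order_path_min ltn_trans)/allP; apply. Qed.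

(* The leftmost triangle of a row has at most one neighbour, so the matching
   is forced from left to right. *)
Lemma M_strip us ds : sorted ltn us -> sorted ltn ds ->
  M (strip us ds) = all2 adjacent_cells us ds.
Proof.
elim: us ds => [|u us IH] [|d ds] su sd /=.
- rewrite (_ : strip _ _ = fset0) ?M0 //; apply/fsetP => -[[i j] b].
  by rewrite !inE !in_row_cells !inE !andbF.
- apply: (@M_isolated _ (d%:Z, 0, false)).
    by rewrite inE !in_row_cells !inE !eqxx.
  move=> [[i j] b]; rewrite inE !in_row_cells !inE share_edgeE !andbF /=.
  by case: b => //=; rewrite ?andbF.
- apply: (@M_isolated _ (u%:Z, 0, true)).
    by rewrite inE !in_row_cells !inE !eqxx.
  move=> [[i j] b]; rewrite inE !in_row_cells !inE share_edgeE !andbF /=.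
  by case: b => //=; rewrite ?andbF.
have uM k : k \in us -> (u < k)%N by apply: path_ltn_mem.
have dM k : k \in ds -> (d < k)%N by apply: path_ltn_mem.
have in_strip i j b : ((i, j, b) \in strip (u :: us) (d :: ds)) =
   [&& j == 0, 0 <= i & if b then (absz i == u) || (absz i \in us)
                        else (absz i == d) || (absz i \in ds)].
  by rewrite inE !in_row_cells !inE; case: b => /=; rewrite ?andbF ?orbF.
have rem : strip us ds = strip (u :: us) (d :: ds) `\` [fset (u%:Z, 0, true); (d%:Z, 0, false)].
  apply/fsetP => -[[i j] b]; rewrite in_fsetD in_strip !inE !in_row_cells !xpair_eqE.
  have := uM (absz i); have := dM (absz i).
  by case: b => /=; case: (absz i \in us); case: (absz i \in ds) => /=; lia.
rewrite /adjacent_cells; case: (ltngtP u d) => [ud|ud|ud] /=.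
- rewrite (_ : u == d.+1 = false) /=; last by lia.
  apply: (@M_isolated _ (u%:Z, 0, true)); first by rewrite in_strip !eqxx.
  move=> [[i j] b]; rewrite in_strip share_edgeE.
  case: b => //=; have := dM (absz i); case: (absz i \in ds) => /=; lia.
- case: (u =P d.+1) => /= [ud'|ud'].
    rewrite -IH; [|exact: path_sorted su|exact: path_sorted sd].
    rewrite rem fsetUC; apply: M_forced.
    + by rewrite in_strip !eqxx.
    + by rewrite in_strip !eqxx.
    + by rewrite share_edgeE /=; lia.
    move=> [[i j] b]; rewrite in_strip share_edgeE; case: b => //= h1 h2.
    have ij : i = u%:Z /\ j = 0.
      by have := uM (absz i); move: h1; case: (absz i \in us) => /=; lia.
    by case: ij => -> ->.
  apply: (@M_isolated _ (d%:Z, 0, false)); first by rewrite in_strip !eqxx.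
  move=> [[i j] b]; rewrite in_strip share_edgeE.
  case: b => //=; have := uM (absz i); case: (absz i \in us) => /=; lia.
rewrite -IH; [|exact: path_sorted su|exact: path_sorted sd].
rewrite rem; apply: M_forced.
+ by rewrite in_strip !eqxx.
+ by rewrite in_strip !eqxx.
+ by rewrite share_edgeE /=; lia.
move=> [[i j] b]; rewrite in_strip share_edgeE; case: b => //= h1 h2.
have ij : i = d%:Z /\ j = 0.
  by have := dM (absz i); move: h1; case: (absz i \in ds) => /=; lia.
by case: ij => -> ->.
Qed.

End OneRow.

(** Sum of [g] over the sequences b1, b2, ... with a1 <= b1 < a2 <= b2 < ... . The value 0 on empty
    [A] fits a row of a trapezoid: it has one more up-pointing than down-pointing cell, so it cannot
    be tiled without a dent. *)
Fixpoint interlacing_sum (A : seq nat) (g : seq nat -> rat) : rat :=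
  if A is a :: A' then
    if A' is a' :: _ then \sum_(a <= b < a') interlacing_sum A' (fun B => g (b :: B))
    else g [::]
  else 0.

(** [A] holds the missing up-pointing cells of a row, [B] the down-pointing ones matched with the
    next row. What is left of the row has a tiling, then a unique one, exactly when [B] interlaces
    [A]. The induction strips the leftmost position [p]. *)
Lemma interlacing_sum_strip p m A g : sorted ltn A ->
  {in A, forall i, (p <= i <= p + m)%N} ->
  \sum_(B <- sublists (iota p m))
    (all2 adjacent_cells [seq i <- iota p m.+1 | i \notin A]
                         [seq i <- iota p m | i \notin B])%:R * g B
  = interlacing_sum A g.
Proof.
elim: m p A g => [|m IH] p A g sA bA.
  rewrite /= big_seq1 /=; case: A sA bA => [|a [|a' A]] /= sA bA.
  - by rewrite mul0r.
  - have -> : a = p by have := bA a (mem_head _ _); lia.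
    by rewrite inE eqxx /= mul1r.
  have := bA a (mem_head _ _); have := bA a'; rewrite !inE eqxx orbT; lia.
rewrite [iota p m.+2]/= [iota p m.+1]/= [sublists _]/= big_cat big_map -[LHS]/(_ + _).
set Y := sublists _; set I := _ :: iota p.+2 m.
have YB B : B \in Y -> p \notin B.
  move/sublists_subseq/mem_subseq => s; apply/negP => /s; rewrite mem_iota; lia.
have Ip i : i \in iota p.+1 m -> (p < i)%N by rewrite mem_iota; lia.
have Ip' i : i \in I -> (p < i)%N by rewrite (_ : I = iota p.+1 m.+1) // mem_iota; lia.
have F1 B : [seq i <- p :: iota p.+1 m | i \notin p :: B] = [seq i <- iota p.+1 m | i \notin B].
  by rewrite /= inE eqxx /=; apply: eq_in_filter => i /Ip; rewrite inE; case: eqP => //; lia.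
have F2 B : B \in Y -> [seq i <- p :: iota p.+1 m | i \notin B] =
    p :: [seq i <- iota p.+1 m | i \notin B].
  by move/YB => /= ->.
under eq_bigr do rewrite F1.
rewrite [X in _ + X]big_seq; under [X in _ + X]eq_bigr => B BY do rewrite (F2 B BY).
rewrite -big_seq.
(* If the up-pointing cell [p] is present, its only possible partner is the down-pointing cell [p],
   so [p] cannot lie in [B] and both cells disappear. *)
case: (boolP (p \in A)) => pA; last first.
  rewrite /= pA.
  rewrite big1 ?add0r => [|B _]; last first.
    case E: [seq i <- iota p.+1 m | _] => [|d ds]; first by rewrite /= mul0r.
    have : (p < d)%N.
      apply: Ip; have : d \in [seq i <- iota p.+1 m | i \notin B] by rewrite E mem_head.
      by rewrite mem_filter => /andP[].
    rewrite /= /adjacent_cells => pd.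
    have -> : (p == d) || (p == d.+1) = false by lia.
    by rewrite mul0r.
  rewrite -(IH p.+1 A g) //; last first.
    move=> i iA; have := bA i iA; have : i != p by apply: contraNneq pA => <-.
    by lia.
  by apply: eq_bigr => B _; rewrite /= {1}/adjacent_cells eqxx.
have [A' def_A] : exists A', A = p :: A'.
  case: A sA bA pA => // a A' /= sA bA; rewrite inE => /orP[/eqP->|pA']; first by exists A'.
  by have := path_ltn_mem sA pA'; have := bA a (mem_head _ _); lia.
subst A; have pA' i : i \in A' -> (p < i)%N by exact: path_ltn_mem.
have sA' : sorted ltn A' by exact: path_sorted sA.
have F3 J : {in J, forall i, (p < i)%N} ->
    [seq i <- p :: J | i \notin p :: A'] = [seq i <- J | i \notin A'].
  move=> pJ; rewrite /= inE eqxx /=; apply: eq_in_filter => i /pJ.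
  by rewrite inE; case: eqP => //; lia.
rewrite (F3 _ Ip') (_ : I = iota p.+1 m.+1) // (IH p.+1 A' (fun B => g (p :: B))) //; last first.
  by move=> i iA; have := pA' i iA; have := bA i; rewrite inE iA orbT; lia.
(* If [p] and [p.+1] are both dents, the down-pointing cell [p] has no partner left in the row, so
   b1 = [p] is the only choice. *)
case: (boolP (p.+1 \in A')) => p1.
  rewrite big1 ?addr0 => [|B _]; last first.
    rewrite /= p1 /=; case E: [seq i <- _ | _] => [|u us]; first by rewrite /= mul0r.
    have : (p.+1 < u)%N.
      have : u \in [seq i <- iota p.+2 m | i \notin A'] by rewrite E mem_head.
      by rewrite mem_filter mem_iota; lia.
    rewrite /= /adjacent_cells => pu.
    have -> : (u == p) || (u == p.+1) = false by lia.
    by rewrite mul0r.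
  case: A' p1 sA' pA' {bA sA pA IH F3} => // a A'.
  rewrite inE => /orP[/eqP<- _ _|p1 sA' pA'] /=; first by rewrite big_nat1.
  by have := path_ltn_mem sA' p1; have := pA' a (mem_head _ _); lia.
(* Otherwise, for [p] outside [B], the down-pointing cell [p] is matched with the up-pointing cell
   [p.+1]. This has the effect of moving the first dent from [p] to [p.+1], and gives the terms b1 >
   [p]. *)
have -> : \sum_(B <- Y) (all2 adjacent_cells [seq i <- iota p.+1 m.+1 | i \notin A']
     (p :: [seq i <- iota p.+1 m | i \notin B]))%:R * g B
   = interlacing_sum (p.+1 :: A') g.
  have pp i : i \in A' -> (p.+1 < i)%N.
    move=> iA; have := pA' i iA; have : i != p.+1 by apply: contraNneq p1 => <-.
    by lia.
  rewrite -(IH p.+1) /=; first last.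
  - move=> i; rewrite inE => /orP[/eqP->|iA]; first by lia.
    by have := pp i iA; have := bA i; rewrite inE iA orbT; lia.
  - by rewrite (path_sortedE ltn_trans) sA' andbT; apply/allP => i /pp.
  apply: eq_bigr => B _; rewrite p1 /= {1}/adjacent_cells eqxx orbT /=.
  congr ((all2 _ _ _)%:R * _); rewrite inE eqxx /=.
  by apply: eq_in_filter => i; rewrite mem_iota inE; case: eqP => //; lia.
case: A' sA' pA' p1 {bA sA pA IH F3} => [|a A'] sA' pA' p1; first by rewrite /= add0r.
have pa : (p.+1 < a)%N.
  by move: p1; rewrite inE; have := pA' a (mem_head _ _); lia.
by rewrite [RHS]/= big_ltn ?[X in _ + X = _]/=; last by lia.
Qed.

Lemma eq_interlacing_sum A g g' : sorted ltn A ->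
  (forall B, size B = (size A).-1 -> sorted ltn B ->
     {in B, forall b, (head 0 A <= b < last 0 A)%N} -> g B = g' B) ->
  interlacing_sum A g = interlacing_sum A g'.
Proof.
elim: A g g' => //= a [|a' A] IH g g' sA H; first exact: H.
have [aa' sA'] := andP sA.
apply: eq_big_nat => b ab; apply: IH => // B sB soB bB; apply: H => /=.
- by rewrite sB.
- rewrite (path_sortedE ltn_trans) soB andbT; apply/allP => k /bB /=; lia.
- have la : (a' <= last a' A)%N.
    by have := mem_last a' A; rewrite inE => /orP[/eqP->//|/(path_ltn_mem sA')/ltnW].
  by move=> k; rewrite inE => /orP[/eqP->|/bB] /=; lia.
Qed.

Lemma interlacing_sum_exchange A (I : seq nat) (g : nat -> seq nat -> rat) :
  \sum_(b <- I) interlacing_sum A (g b) =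
  interlacing_sum A (fun B => \sum_(b <- I) g b B).
Proof.
elim: A g => [|a [|a' A] IH] g //=; first by rewrite big1.
rewrite exchange_big; apply: eq_bigr => b _.
exact: (IH (fun c B => g c (b :: B))).
Qed.

(** * Binomial determinants and Vandermonde products *)

Section Alternants.

(** Keeping the rows in a list lets an induction transform them one by one while the dimension stays
    fixed. *)
Definition row_det n (vs : seq (nat -> rat)) : rat :=
  \det (\matrix_(i < n, j < n) nth (fun=> 0) vs i j).

Lemma nth_cat_cons_neq (T : Type) (d x y : T) s t k : k != size s ->
  nth d (s ++ x :: t) k = nth d (s ++ y :: t) k.
Proof.
move=> ks; rewrite !nth_cat; case: ltnP => // sk.
by case E: (k - size s)%N => //; lia.
Qed.

Lemma row_det_rowE n (s t : seq (nat -> rat)) x y (i0 : 'I_n) : i0 = size s :> nat ->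
  row' i0 (\matrix_(i < n, j < n) nth (fun=> 0 : rat) (s ++ x :: t) i j) =
  row' i0 (\matrix_(i < n, j < n) nth (fun=> 0) (s ++ y :: t) i j).
Proof.
move=> i0s; apply/matrixP => i j; rewrite !mxE.
rewrite (nth_cat_cons_neq _ x y) //.
by rewrite -i0s; have := neq_lift i0 i; rewrite eq_sym -val_eqE.
Qed.

Lemma row_det_sum n s t (I : seq nat) (v : nat -> nat -> rat) : (size s < n)%N ->
  row_det n (s ++ (fun j => \sum_(b <- I) v b j) :: t) =
  \sum_(b <- I) row_det n (s ++ v b :: t).
Proof.
move=> sn; pose i0 := Ordinal sn.
rewrite /row_det (expand_det_row _ i0).
under [RHS]eq_bigr => b _ do rewrite (expand_det_row _ i0).
rewrite exchange_big; apply: eq_bigr => j _.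
rewrite mxE nth_cat ltnn subnn /= mulr_suml; apply: eq_bigr => b _.
rewrite mxE nth_cat ltnn subnn /=; congr (_ * _); rewrite /cofactor; congr (_ * \det _).
apply/matrixP => k l; rewrite !mxE (nth_cat_cons_neq _ _ (v b)) //.
by have := neq_lift i0 k; rewrite eq_sym -val_eqE.
Qed.

(** Linearity in the row after [v]: the part [- v] repeats the row [v] and contributes nothing. *)
Lemma row_det_sub n s t (v w : nat -> rat) : ((size s).+1 < n)%N ->
  row_det n (s ++ v :: (fun j => w j - v j) :: t) = row_det n (s ++ v :: w :: t).
Proof.
move=> sn; have sn' := ltnW sn; pose i0 := Ordinal sn; pose i1 := Ordinal sn'.
have E x : s ++ v :: x :: t = rcons s v ++ x :: t by rewrite cat_rcons.
have i0E : i0 = size (rcons s v) :> nat by rewrite size_rcons.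
rewrite /row_det (@determinant_multilinear _ _ _
  (\matrix_(i < n, j < n) nth (fun=> 0) (s ++ v :: w :: t) i j)
  (\matrix_(i < n, j < n) nth (fun=> 0) (s ++ v :: v :: t) i j) i0 1 (-1)).
- have i10 : i1 != i0 by rewrite -val_eqE /=; lia.
  rewrite mul1r [X in _ * X](determinant_alternate i10) ?mulr0 ?addr0 // => j.
  by rewrite !mxE /= !nth_cat ltnn subnn subSnn ltnNge leqnSn.
- by apply/matrixP => i j; rewrite !mxE !E !nth_cat !size_rcons ltnn subnn /= mul1r mulN1r.
- by rewrite !E; exact: (row_det_rowE t _ _ i0E).
- by rewrite !E; exact: (row_det_rowE t _ _ i0E).
Qed.

Definition binom_row (a : nat) : nat -> rat := fun j => 'C(a, j)%:R.
(** By Pascal's rule this is [binom_row a] shifted one column to the right, with 0 in column 0. *)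
Definition binom_diff (a : nat) : nat -> rat := fun j => 'C(a.+1, j)%:R - 'C(a, j)%:R.

(* The differences telescope over a gap of A to a difference of two binomial
   rows, and adding the preceding row leaves a single binomial row. *)
Lemma interlacing_sum_row_det s a A : sorted ltn (a :: A) ->
  interlacing_sum (a :: A)
    (fun B => row_det (size s + (size A).+1) (s ++ binom_row a :: map binom_diff B)) =
  row_det (size s + (size A).+1) (s ++ map binom_row (a :: A)).
Proof.
elim: A s a => [|a' A IH] s a; first by [].
case/andP=> aa' sA.
pose g b B := row_det (size s + (size A).+2) (s ++ binom_row a :: map binom_diff (b :: B)).
rewrite -[LHS]/(\sum_(a <= b < a') interlacing_sum (a' :: A) (g b)).
rewrite interlacing_sum_exchange {}/g.
have := IH (rcons s (binom_row a)) a' sA.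
rewrite size_rcons addSnnS cat_rcons => <-.
apply: eq_interlacing_sum => // B _ _ _ /=.
rewrite cat_rcons -row_det_sub; last by lia.
under eq_bigr do rewrite -cat_rcons.
rewrite -row_det_sum; last by rewrite size_rcons !addnS !ltnS leq_addr.
rewrite -[X in _ = row_det _ X]cat_rcons /row_det; congr (\det _); apply/matrixP => i j; rewrite !mxE.
rewrite !nth_cat; case: ifP => // _; case: (_ - _)%N => //=.
exact: (telescope_sumr (fun k => 'C(k, j)%:R : rat) (ltnW aa')).
Qed.

(** Column 0 has a single nonzero entry, the 1 of the first row; deleting both undoes the shift in
    the difference rows. *)
Lemma row_det_border a B :
  row_det (size B).+1 (binom_row a :: map binom_diff B) =
  row_det (size B) (map binom_row B).
Proof.
rewrite /row_det (expand_det_col _ ord0) big_ord_recl big1 ?addr0 => [|i _]; last first.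
  by rewrite !mxE /= add0n (nth_map 0%N) // /binom_diff !bin0 subrr mul0r.
rewrite mxE /= /binom_row bin0 mul1r /cofactor expr0 mul1r; congr (\det _).
apply/matrixP => i j; rewrite !mxE /= !add0n !(nth_map 0%N) //.
by rewrite /binom_diff binS natrD addrAC subrr add0r.
Qed.

Definition binom_det (A : seq nat) : rat := row_det (size A) (map binom_row A).

(** The determinant of [B] is one row short of that of [a :: A]. Bordering it by [binom_row a] makes
    the sizes agree, and the sum can then be taken row by row. This is the recursion that peeling
    off a row of a trapezoid produces. *)
Lemma interlacing_sum_binom_det a A : sorted ltn (a :: A) ->
  interlacing_sum (a :: A) binom_det = binom_det (a :: A).
Proof.
move=> sA; rewrite /binom_det -(interlacing_sum_row_det [::] sA).
apply: eq_interlacing_sum => // B /= sB _ _.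
by rewrite -(row_det_border a) sB.
Qed.

End Alternants.

(* The absolute difference: one of the two truncated subtractions is zero. *)
Definition dist (x y : nat) : nat := (x - y) + (y - x).

(** The Vandermonde product without its sign: a natural number, invariant under permutations, so
    dents may be listed in any order. *)
Fixpoint vdm (s : seq nat) : nat :=
  if s is x :: s' then (\prod_(y <- s') dist x y) * vdm s' else 1.

Definition superfact (n : nat) : nat := \prod_(i < n) i`!.

Lemma vdm_sorted A : sorted ltn A ->
  \prod_(i < size A) \prod_(j < size A | (i < j)%N) ((nth 0%N A j)%:R - (nth 0%N A i)%:R)
  = (vdm A)%:R :> rat.
Proof.
elim: A => [|a A IH] sA; first by rewrite big_ord0.
rewrite [size _]/= big_ord_recl /= natrM -IH; last exact: path_sorted sA.
congr (_ * _).
  rewrite big_mkcond big_ord_recl /= mul1r natr_prod (big_nth 0%N) big_mkord.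
  apply: eq_bigr => i _; rewrite /dist ?add0n.
  have : (a < nth 0 A i)%N by apply: (path_ltn_mem sA); exact: mem_nth.
  by move=> ai; rewrite -natrB ?(ltnW ai) //; congr (_%:R); lia.
apply: eq_bigr => i _; rewrite big_mkcond big_ord_recl /= mul1r -big_mkcond /=.
by apply: eq_bigl => j; rewrite /bump /= !add1n ltnS.
Qed.

Lemma binom_det_vdm A : sorted ltn A ->
  binom_det A * (superfact (size A))%:R = (vdm A)%:R.
Proof.
move=> sA; rewrite -vdm_sorted //; set n := size A.
(* [p j] is the falling factorial, monic of degree j. Multiplying column j of the binomial matrix by
   j! therefore gives a Vandermonde matrix times a unitriangular matrix [U]. *)
pose p (j : nat) : {poly rat} := \prod_(k < j) ('X - (k%:R)%:P).
have pE (a j : nat) : (p j).[a%:R] = (a ^_ j)%:R.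
  elim: j => [|j IH]; first by rewrite /p big_ord0 hornerC ffactn0.
  rewrite /p big_ord_recr /= hornerM -/(p j) IH ffactnSr natrM !hornerE.
  have [ja|ja] := leqP j a; first by rewrite natrB.
  by rewrite ffact_small // !mul0r.
have sp j : size (p j) = j.+1.
  by rewrite /p -(big_mkord xpredT (fun k => 'X - (k%:R)%:P)) size_prod_XsubC size_iota subn0.
have mp j : (p j)`_j = 1.
  have : p j \is monic by apply: monic_prod_XsubC.
  by rewrite monicE /lead_coef sp => /eqP.
pose av : 'rV[rat]_n := \row_i (nth 0%N A i)%:R.
pose U : 'M[rat]_n := \matrix_(k, j) (p j)`_k.
pose D : 'rV[rat]_n := \row_j (j`!)%:R.
have -> : \prod_(i < n) \prod_(j < n | (i < j)%N) ((nth 0%N A j)%:R - (nth 0%N A i)%:R)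
   = \det (Vandermonde n av).
  rewrite det_Vandermonde; apply: eq_bigr => i _; apply: eq_bigr => j _.
  by rewrite !mxE.
have detU : \det U = 1.
  rewrite -det_tr det_trig; first by rewrite big1 // => i _; rewrite !mxE mp.
  apply/is_trig_mxP => i j ij; rewrite !mxE nth_default // sp.
  by [].
rewrite -[RHS]mulr1 -[X in _ = _ * X]detU -[X in _ = X * _]det_tr -[RHS]det_mulmx.
rewrite [X in _ * X = _](_ : _ = \det (diag_mx D)); last first.
  by rewrite det_diag natr_prod; apply: eq_bigr => i _; rewrite mxE.
rewrite -det_mulmx; congr (\det _); apply/matrixP => i j.
rewrite mul_mx_diag !mxE (nth_map 0%N) // /binom_row -natrM bin_ffact -pE.
rewrite (@horner_coef_wide _ n) ?sp //; apply: eq_bigr => k _.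
by rewrite !mxE mulrC.
Qed.

(** * Trapezoids with unit dents on the long base *)

Section DentedTrapezoids.
Local Open Scope fset_scope.
Local Open Scope ring_scope.

Lemma M_translate (R R' : region) (di dj : int) :
  (forall i j b, ((i, j, b) \in R') = ((i - di, j - dj, b) \in R)) -> M R' = M R.
Proof.
move=> H; pose f (t : triangle) : triangle := (t.1.1 + di, t.1.2 + dj, t.2).
have fI : injective f.
  by move=> [[i j] b] [[i' j'] b'] [/addIr-> /addIr-> ->].
rewrite -(@M_imfset f R) //.
  congr (M _); apply/fsetP => -[[i j] b]; rewrite H; apply/idP/imfsetP => /= [h|].
    by exists (i - di, j - dj, b) => //; rewrite /f /= !subrK.
  by case=> -[[i' j'] b'] h [-> -> ->]; rewrite /= !addrK.
move=> [[i j] b] [[i' j'] b']; rewrite !share_edgeE /=.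
by case: b => /=; congr (_ && _); lia.
Qed.

Lemma M_rotate (R R' : region) (p q : int) :
  (forall i j b, ((i, j, b) \in R') = ((p - i, q - j, ~~ b) \in R)) -> M R' = M R.
Proof.
move=> H; pose f (t : triangle) : triangle := (p - t.1.1, q - t.1.2, ~~ t.2).
have fI : injective f.
  by move=> [[i j] b] [[i' j'] b'] [/addrI/oppr_inj-> /addrI/oppr_inj-> /negb_inj->].
rewrite -(@M_imfset f R) //.
  congr (M _); apply/fsetP => -[[i j] b]; rewrite H; apply/idP/imfsetP => /= [h|].
    by exists (p - i, q - j, ~~ b) => //; rewrite /f /= !subKr negbK.
  by case=> -[[i' j'] b'] h [-> -> ->]; rewrite /= !subKr negbK.
move=> [[i j] b] [[i' j'] b']; rewrite !share_edgeE /=.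
by case: b b' => [] [] //=; lia.
Qed.

Definition trapezoid (N n : nat) : region := polygon 0 n%:Z 0 N%:Z 0 n%:Z.

Lemma in_trapezoid N n (i j : int) up : ((i, j, up) \in trapezoid N n) =
  [&& 0 <= i, 0 <= j, j + 1 <= N%:Z &
      if up then i + j + 1 <= n%:Z else i + j + 2 <= n%:Z].
Proof. by rewrite in_polygonE; case: up; lia. Qed.

(* The guard discards dents outside the (empty) trapezoid with no row. *)
Definition dented_count (N n : nat) (A : seq nat) : rat :=
  if (0 < N)%N || (A == [::]) then (M (trapezoid N n `\` row_cells 0 true A))%:R else 0.

Lemma interlacing_sum0 A : interlacing_sum A (fun=> 0) = 0.
Proof. by elim: A => //= a [|a' A] // IH; rewrite big1. Qed.

(** Cut along the line above the bottom row: the lozenges crossing it are the dents of the remaining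
    trapezoid, and they interlace [A]. *)
Lemma dented_count_peel N n A : (N <= n)%N -> sorted ltn A ->
  {in A, forall i, (i < n.+1)%N} ->
  dented_count N.+1 n.+1 A = interlacing_sum A (dented_count N n).
Proof.
move=> Nn sA bA; rewrite -(@interlacing_sum_strip 0 n) //.
rewrite -[dented_count _ _ A]/((M (trapezoid N.+1 n.+1 `\` row_cells 0 true A))%:R : rat).
rewrite /dented_count (@M_cut _ 1 (iota 0 n)) ?iota_uniq //; last first.
  move=> i; rewrite !in_fsetD !in_trapezoid !in_row_cells => h1 h2; exists (absz i).
    by rewrite mem_iota; lia.
  by lia.
rewrite natr_sum [LHS]big_seq [RHS]big_seq; apply: eq_bigr => B BI.
have sBI := sublists_subseq BI.
have bB k : k \in B -> (k < n)%N by move/(mem_subseq sBI); rewrite mem_iota; lia.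
set c := all _ _.
(* A lozenge can cross only if there is a row above; this is exactly the guard in [dented_count]. *)
have -> : c = (0 < N)%N || (B == [::]).
  rewrite {}/c; case: B bB {BI sBI} => [|k B] bB; first by rewrite orbT.
  rewrite orbF; apply/allP/idP => [/(_ k (mem_head _ _))|N0 l /bB ln].
    by rewrite in_fsetD in_trapezoid => /andP[/andP[_ /and4P[_ _ h _]] _]; lia.
  by apply/andP; split; rewrite in_fsetD in_trapezoid in_row_cells ?andbF //=; lia.
case: ifP => _; last by rewrite mulr0.
rewrite natrM mulrC; congr (_%:R * _%:R).
  rewrite -M_strip ?(sorted_filter ltn_trans) ?iota_ltn_sorted //.
  congr (M _); apply/fsetP => -[[i j] b].
  rewrite in_fsetU in_fsetD in_below in_fsetD in_trapezoid !in_row_cells.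
  rewrite !mem_filter !mem_iota.
  by case: b => /=; case: (absz i \in A); case: (absz i \in B); lia.
apply: (@M_translate _ _ 0 1) => i j b; rewrite in_fsetD in_above !in_fsetD !in_trapezoid !in_row_cells subr0.
by case: b; case: (absz i \in B); case: (absz i \in A) => /=; lia.
Qed.

(** Tilings and binomial determinants obey the same interlacing recursion. Each peeled row uses up
    one dent, whence the condition on the size of [A]. *)
Lemma dented_countE N n A : (N <= n)%N -> sorted ltn A -> {in A, forall i, (i < n)%N} ->
  dented_count N n A = if size A == N then binom_det A else 0.
Proof.
elim: N n A => [|N IH] n A.
  move=> _ _ _; rewrite /dented_count; case: A => //=.
  rewrite (_ : _ `\` _ = fset0) ?M0 /binom_det /row_det ?det_mx00 //.
  by apply/fsetP => -[[i j] b]; rewrite in_fset0 in_fsetD in_trapezoid; lia.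
case: n => // n Nn sA bA; rewrite dented_count_peel //.
case: A sA bA => [|a A] sA bA //.
rewrite eqSS (@eq_interlacing_sum _ _ (fun B => if size A == N then binom_det B else 0)) //.
  case: eqP => _; last exact: interlacing_sum0.
  exact: interlacing_sum_binom_det.
move=> B sB soB bB; rewrite IH ?sB // => i /bB /andP[_ il].
by have := bA _ (mem_last a A); move: il => /=; lia.
Qed.

Lemma dented_count_vdm N n A : (N <= n)%N -> sorted ltn A -> {in A, forall i, (i < n)%N} ->
  dented_count N n A * (superfact N)%:R = if size A == N then (vdm A)%:R else 0.
Proof.
move=> Nn sA bA; rewrite dented_countE //; case: eqP => [<-|_]; last by rewrite mul0r.
exact: binom_det_vdm.
Qed.

End DentedTrapezoids.

(** * Products of distances *)

Section VdmTheory.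
Local Open Scope nat_scope.

Definition cross (s t : seq nat) : nat := \prod_(x <- s) \prod_(y <- t) dist x y.

Lemma distC x y : dist x y = dist y x.
Proof. by rewrite /dist addnC. Qed.

Lemma vdm_mid x s t : vdm (s ++ x :: t) = (\prod_(y <- s ++ t) dist x y) * vdm (s ++ t).
Proof.
elim: s => //= a s ->; rewrite big_cons !big_cat big_cons /= (distC a x).
by rewrite !mulnA; congr (_ * _); nia.
Qed.

Lemma vdm_perm s t : perm_eq s t -> vdm s = vdm t.
Proof.
elim: s t => [|x s IH] t; first by move/perm_size/esym/size0nil->.
move=> p; have xt : x \in t by rewrite -(perm_mem p) mem_head.
move: p; case/splitPr: xt => t1 t2 p; rewrite vdm_mid /=.
have p' : perm_eq s (t1 ++ t2).
  by move: p; rewrite perm_sym -cat1s perm_catCA /= perm_cons perm_sym.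
by rewrite (IH _ p') (perm_big _ p').
Qed.

Lemma vdm_cat s t : vdm (s ++ t) = vdm s * vdm t * cross s t.
Proof.
elim: s => [|x s IH] /=; first by rewrite /cross big_nil mul1n muln1.
by rewrite IH /cross big_cons big_cat /=; nia.
Qed.

Lemma cross_catl s s' t : cross (s ++ s') t = cross s t * cross s' t.
Proof. exact: big_cat. Qed.

Lemma cross_perm s s' t : perm_eq s s' -> cross s t = cross s' t.
Proof. exact: perm_big. Qed.

Lemma vdm_map (f : nat -> nat) s : {in s &, forall x y, dist (f x) (f y) = dist x y} ->
  vdm (map f s) = vdm s.
Proof.
elim: s => //= x s IH H; rewrite IH; last by move=> a b ha hb; apply: H; rewrite inE ?ha ?hb orbT.
congr (_ * _); rewrite big_map !big_seq; apply: eq_bigr => y ys.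
by apply: H; rewrite inE ?eqxx ?ys ?orbT.
Qed.

End VdmTheory.

(** * Triangular dents reduced to unit dents by forced lozenges *)

Section TriangularDents.
Local Open Scope fset_scope.
Local Open Scope ring_scope.

Lemma in_up_triangle (p q i j : int) (t : nat) up :
  ((i, j, up) \in up_triangle p q t) =
  [&& p <= i, q <= j & if up then i + j + 1 <= p + q + t%:Z else i + j + 2 <= p + q + t%:Z].
Proof. by rewrite in_polygonE; case: up; lia. Qed.

Lemma in_down_triangle (p q i j : int) (t : nat) up :
  ((i, j, up) \in down_triangle p q t) =
  [&& i + 1 <= p + t%:Z, j + 1 <= q & if up then p + q <= i + j else p + q <= i + j + 1].
Proof. by rewrite in_polygonE; case: up; lia. Qed.

(** The down-pointing cells [ds] have lost both neighbours in their own row, so each must be matched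
    with the cell above it. *)
Lemma M_forced_row R (j : int) (ds : seq nat) : uniq ds ->
  {in ds, forall k : nat, [/\ (k%:Z, j, false) \in R, (k%:Z, j + 1, true) \in R,
     (k%:Z, j, true) \notin R & (k%:Z + 1, j, true) \notin R]} ->
  M R = M (R `\` (row_cells j false ds `|` row_cells (j + 1) true ds)).
Proof.
elim: ds R => [|k ds IH] R /=.
  move=> _ _; congr (M _); apply/fsetP => -[[i j'] b].
  by rewrite in_fsetD in_fsetU !in_row_cells !in_nil !andbF.
move=> /andP[kds uds] H; have [h1 h2 h3 h4] := H k (mem_head _ _).
rewrite (M_forced h1 h2); first last.
- move=> [[i j'] b] hR; rewrite share_edgeE; case: b hR => //= hR.
  case/orP => [/andP[/eqP e1 /orP[] /eqP e2]|/andP[/eqP-> /eqP->]] //; subst.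
    by rewrite hR in h3.
  by rewrite hR in h4.
- by rewrite share_edgeE !eqxx orbT.
rewrite IH //.
  congr (M _); apply/fsetP => -[[i j'] b].
  rewrite !in_fsetD !in_fsetU !in_row_cells !in_fset1 !inE !xpair_eqE.
  case: ((i, j', b) \in R); rewrite ?andbF // !andbT.
  by case: b; case: (absz i \in ds); lia.
move=> l lds; have [g1 g2 g3 g4] := H l (mem_behead (s := k :: ds) lds).
have lk : l != k by apply: contraNneq kds => <-.
by split; rewrite in_fsetD ?g1 ?g2 ?(negPf g3) ?(negPf g4) ?andbF // !inE !xpair_eqE; lia.
Qed.

(** Once the base row of up-pointing cells is gone, vertical lozenges are forced in the rest of the
    triangle, row after row; each forced row leaves a triangle of side one less without its base
    cells. *)
Lemma M_forced_triangle R (i t : nat) (j : int) : up_triangle i%:Z j t `<=` R ->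
  M (R `\` up_triangle i%:Z j t) = M (R `\` row_cells j true (iota i t)).
Proof.
elim: t j R => [|t IH] j R sR.
  congr (M _); apply/fsetP => -[[i' j'] b].
  by rewrite !in_fsetD in_up_triangle in_row_cells in_nil !andbF; case: b; lia.
have inR i' j' b : (i', j', b) \in up_triangle i%:Z j t.+1 -> (i', j', b) \in R.
  by move/(fsubsetP sR).
rewrite [RHS](@M_forced_row _ j (iota i t)) ?iota_uniq //; last first.
  move=> k; rewrite mem_iota => kt.
  have h1 : (k%:Z, j, false) \in R by apply: inR; rewrite in_up_triangle; lia.
  have h2 : (k%:Z, j + 1, true) \in R by apply: inR; rewrite in_up_triangle; lia.
  by split; rewrite in_fsetD in_row_cells ?h1 ?h2 ?andbT mem_iota; lia.
rewrite -fsetDDl -IH; last first.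
  apply/fsubsetP => -[[i' j'] b] h; rewrite !in_fsetD !in_row_cells inR ?andbT.
    by move: h; rewrite in_up_triangle; case: b; lia.
  by move: h; rewrite !in_up_triangle; case: b; lia.
congr (M _); apply/fsetP => -[[i' j'] b].
rewrite !in_fsetD !in_up_triangle !in_row_cells !mem_iota.
by case: ((i', j', b) \in R); rewrite ?andbF // !andbT; case: b; lia.
Qed.

(** A pair (p, t) stands for a triangle of side t whose edge on the line starts at abscissa p; here
    it is replaced by the unit dents along that edge. *)
Definition cells (TL : seq (nat * nat)) : seq nat := flatten [seq iota p.1 p.2 | p <- TL].

Definition up_triangles (j : int) (TL : seq (nat * nat)) : region :=
  \bigcup_(p <- TL) up_triangle p.1%:Z j p.2.

Lemma M_triangular_dents R (j : int) TL : uniq (cells TL) ->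
  {in TL, forall p, up_triangle p.1%:Z j p.2 `<=` R} ->
  M (R `\` up_triangles j TL) = M (R `\` row_cells j true (cells TL)).
Proof.
elim: TL R => [|[p t] TL IH] R uT H.
  congr (M _); apply/fsetP => -[[i' j'] b].
  by rewrite !in_fsetD in_row_cells in_nil !andbF /up_triangles big_nil.
move: uT; rewrite [cells _]/= cat_uniq -/(cells TL) => /and3P[_ dT uT].
have dis k : (p <= k < p + t)%N -> k \notin cells TL.
  by move=> kp; apply: contra dT => kT; apply/hasP; exists k; rewrite ?mem_iota.
have Hp := H _ (mem_head _ _).
rewrite /up_triangles big_cons -fsetDDl -/(up_triangles j TL) IH //; last first.
  move=> [p' t'] pT; apply/fsubsetP => -[[i' j'] b] h; rewrite in_fsetD.
  rewrite (fsubsetP (H _ (mem_behead (s := _ :: TL) pT)) _ h) andbT.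
  apply/negP => h'; have /negP[] : absz i' \notin cells TL.
    by apply: dis; move: h'; rewrite in_up_triangle /=; case: b h; lia.
  apply/flattenP; exists (iota p' t'); first by apply/mapP; exists (p', t').
  by move: h h'; rewrite !in_up_triangle mem_iota /=; case: b; lia.
rewrite fsetDDl fsetUC -fsetDDl M_forced_triangle.
  congr (M _); apply/fsetP => -[[i' j'] b].
  rewrite !in_fsetD !in_row_cells mem_cat mem_iota.
  by case: ((i', j', b) \in R); rewrite ?andbF // !andbT; case: (absz i' \in cells TL); lia.
apply/fsubsetP => -[[i' j'] b] h; rewrite in_fsetD (fsubsetP Hp _ h) andbT in_row_cells.
have : absz i' \notin cells TL.
  by apply: dis; move: h; rewrite in_up_triangle /=; case: b; lia.
by case: (absz i' \in _) => //; rewrite !andbF.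
Qed.

End TriangularDents.

(** * Tilings of a hexagon cut along the line of its ferns *)

Section CutHexagon.
Local Open Scope fset_scope.
Local Open Scope ring_scope.

Lemma mem_cells TL k :
  reflect (exists2 p, p \in TL & (p.1 <= k < p.1 + p.2)%N) (k \in cells TL).
Proof.
apply: (iffP flattenP) => [[s /mapP[p pT ->]]|[p pT kp]].
  by rewrite mem_iota; exists p.
by exists (iota p.1 p.2); rewrite ?mem_iota //; apply/mapP; exists p.
Qed.

Lemma side_le_cells TL p : p \in TL -> (p.2 <= size (cells TL))%N.
Proof.
elim: TL => // q TL IH; rewrite inE [cells _]/= size_cat size_iota.
by case/orP => [/eqP->|/IH]; rewrite ?leq_addr // => h; exact: leq_trans h (leq_addl _ _).
Qed.

Lemma dented_triangles_vdm N n TL S : (N <= n)%N -> uniq (cells TL ++ S) ->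
  {in cells TL ++ S, forall k, (k < n)%N} -> {in TL, forall p, (p.2 <= N)%N} ->
  (0 < N)%N || (S == [::]) ->
  (M ((trapezoid N n `\` up_triangles 0 TL) `\` row_cells 0 true S) * superfact N)%N =
  if size (cells TL ++ S) == N then vdm (cells TL ++ S) else 0%N.
Proof.
(* The trapezoid count needs increasing dents; afterwards [vdm] forgets the order again. *)
move=> Nn uA bA tN g0; pose A := sort leq (cells TL ++ S).
have pA : perm_eq A (cells TL ++ S) by rewrite perm_sort.
have sA : sorted ltn A by rewrite ltn_sorted_uniq_leq (perm_uniq pA) uA (sort_sorted leq_total).
have bA' : {in A, forall k, (k < n)%N} by move=> k; rewrite (perm_mem pA) => /bA.
have [uT dTS uS] := and3P (etrans (esym (cat_uniq _ _)) uA).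
have := dented_count_vdm Nn sA bA'; rewrite (perm_size pA) (vdm_perm pA).
have g : (0 < N)%N || (A == [::]).
  case: N Nn tN g0 => // _ tN /= /eqP S0.
  rewrite -size_eq0 (perm_size pA) S0 cats0; apply/negPn/negP => c0.
  have : nth 0%N (cells TL) 0 \in cells TL by apply: mem_nth; lia.
  by case/mem_cells => -[p t] /tN /= h1 h2; lia.
rewrite /dented_count g.
have -> : M ((trapezoid N n `\` up_triangles 0 TL) `\` row_cells 0 true S)
        = M (trapezoid N n `\` row_cells 0 true A).
  rewrite fsetDDl fsetUC -fsetDDl M_triangular_dents //.
    congr (M _); apply/fsetP => -[[i j] b].
    rewrite !in_fsetD !in_row_cells (perm_mem pA) mem_cat.
    by case: (_ \in trapezoid _ _); rewrite ?andbF // !andbT;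
      case: (absz i \in S); case: (absz i \in cells TL); lia.
  move=> [p t] pT; apply/fsubsetP => -[[i j] b].
  rewrite in_up_triangle in_fsetD in_trapezoid in_row_cells /= => h.
  have tn := tN _ pT.
  have hi k : (p <= k < p + t)%N -> k \in cells TL by move=> kp; apply/mem_cells; exists (p, t).
  have ti : (0 < t)%N by case: b h; lia.
  have pt : (p + t <= n)%N.
    have : (p + t.-1 < n)%N by apply: bA; rewrite mem_cat hi //; lia.
    by lia.
  have nS : absz i \notin S.
    by apply: contra dTS => iS; apply/hasP; exists (absz i) => //; apply: hi; case: b h; lia.
  move: tn => /= tn; rewrite (negPf nS) !andbF /=; case: b h; lia.
rewrite -natrM; case: ifP => _ /eqP; rewrite ?eqr_nat; first by move/eqP.
by rewrite (eqr_nat _ _ 0) => /eqP.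
Qed.

Definition down_triangles (j : int) (TL : seq (nat * nat)) : region :=
  \bigcup_(p <- TL) down_triangle p.1%:Z j p.2.

Lemma in_up_triangles t j TL :
  reflect (exists2 p, p \in TL & t \in up_triangle p.1%:Z j p.2) (t \in up_triangles j TL).
Proof.
rewrite /up_triangles; apply: (iffP idP) => [/bigfcupP[p]|[p pT h]]; first by rewrite andbT => pT; exists p.
by apply/bigfcupP; exists p; rewrite ?pT.
Qed.

Lemma in_down_triangles t j TL :
  reflect (exists2 p, p \in TL & t \in down_triangle p.1%:Z j p.2) (t \in down_triangles j TL).
Proof.
rewrite /down_triangles; apply: (iffP idP) => [/bigfcupP[p]|[p pT h]]; first by rewrite andbT => pT; exists p.
by apply/bigfcupP; exists p; rewrite ?pT.
Qed.

Lemma up_triangles_row (i : nat) (j : int) TL :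
  ((i%:Z, j, true) \in up_triangles j TL) = (i \in cells TL).
Proof.
apply/in_up_triangles/mem_cells => -[[p t] pT h]; exists (p, t) => //; move: h;
by rewrite in_up_triangle /=; lia.
Qed.

Lemma down_triangles_row (i : nat) (j : int) TL :
  ((i%:Z, j - 1, false) \in down_triangles j TL) = (i \in cells TL).
Proof.
apply/in_down_triangles/mem_cells => -[[p t] pT h]; exists (p, t) => //; move: h;
by rewrite in_down_triangle /=; lia.
Qed.

Lemma up_triangles_below i (j j' : int) b TL : j' < j ->
  (i, j', b) \notin up_triangles j TL.
Proof.
by move=> jj; apply/in_up_triangles => -[p pT]; rewrite in_up_triangle; lia.
Qed.

Lemma down_triangles_above i (j j' : int) b TL : j <= j' ->
  (i, j', b) \notin down_triangles j TL.
Proof.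
by move=> jj; apply/in_down_triangles => -[p pT]; rewrite in_down_triangle; lia.
Qed.

(* The row -L of the cut lies L rows below the west vertex (0, 0) and Rt rows
   above the east vertex; it meets the hexagon in a segment of length k and is
   crossed by z vertical lozenges. *)
Definition cut_hexagon (L Rt z k : nat) (UL DL : seq (nat * nat)) : region :=
  polygon 0 (L + k + Rt)%N%:Z (- (L + Rt + size (cells DL) + z)%N%:Z)
          (size (cells UL) + z)%N%:Z 0 k%:Z
    `\` (up_triangles (- L%:Z) UL `|` down_triangles (- L%:Z) DL).

(** Half turn of a line of length [W], applied to unit cells and to triangles: the old right end of
    a triangle gives its new left end. *)
Definition flip (W : nat) (k : nat) : nat := (W - k.+1)%N.
Definition flip_dent (W : nat) (p : nat * nat) : nat * nat := ((W - (p.1 + p.2))%N, p.2).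

Lemma cells_flip W TL : {in cells TL, forall k, (k < W)%N} ->
  perm_eq (cells (map (flip_dent W) TL)) (map (flip W) (cells TL)).
Proof.
elim: TL => // [[p t] TL] IH; rewrite [cells _]/= [cells (map _ _)]/= map_cat => H.
apply: perm_cat; last by apply: IH => k kT; apply: H; rewrite mem_cat kT orbT.
have pW k : (p <= k < p + t)%N -> (k < W)%N.
  by move=> kp; apply: H; rewrite mem_cat mem_iota kp.
apply: uniq_perm => [||k]; first exact: iota_uniq.
  rewrite map_inj_in_uniq ?iota_uniq // => x y; rewrite !mem_iota => /pW xW /pW yW.
  by rewrite /flip; lia.
rewrite mem_iota /=; apply/idP/mapP => [kp|[x]].
  have := pW (p + t).-1; exists (W - k.+1)%N; rewrite ?mem_iota /flip; lia.
by rewrite mem_iota => xp ->; have := pW _ xp; rewrite /flip; lia.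
Qed.

Section Count.
Variables (L Rt z k : nat) (UL DL : seq (nat * nat)) (G : seq nat).
Hypothesis perm_cells : perm_eq (cells UL ++ cells DL ++ G) (iota L k).
Hypothesis z_le : (z <= size G)%N.

Let W := (L + k + Rt)%N.
Let u := size (cells UL).
Let d := size (cells DL).

Let uniq_cells : uniq (cells UL ++ cells DL ++ G).
Proof. by rewrite (perm_uniq perm_cells) iota_uniq. Qed.

Let size_cells : (u + d + size G)%N = k.
Proof. by have := perm_size perm_cells; rewrite !size_cat size_iota -addnA. Qed.

Let range i : i \in cells UL ++ cells DL ++ G -> (L <= i < L + k)%N.
Proof. by rewrite (perm_mem perm_cells) mem_iota. Qed.

Let rangeD i : i \in cells DL -> (L <= i < L + k)%N.
Proof. by move=> h; apply: range; rewrite !mem_cat h orbT. Qed.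

(** Between the cut and the west vertex the left boundary leans inwards. Restoring a corner triangle
    of side [L] makes the upper half a trapezoid, and the corner becomes the extra dent [(0, L)]. *)
Lemma above_cut_hexagon (S : seq nat) :
  M (above (- L%:Z) (cut_hexagon L Rt z k UL DL) `\` row_cells (- L%:Z) true S) =
  M ((trapezoid (L + u + z) (L + k) `\` up_triangles 0 ((0%N, L) :: UL))
       `\` row_cells 0 true S).
Proof.
apply: (@M_translate _ _ 0 (- L%:Z)) => i j b.
rewrite in_fsetD in_above !in_fsetD in_fsetU in_polygonE in_trapezoid !in_row_cells subr0.
have -> : ((i, j, b) \in down_triangles (- L%:Z) DL) = ~~ (- L%:Z <= j) && ((i, j, b) \in down_triangles (- L%:Z) DL).
  apply/esym/andb_idl => /in_down_triangles[p _]; rewrite in_down_triangle; lia.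
have -> : ((i, j - - L%:Z, b) \in up_triangles 0 ((0%N, L) :: UL)) =
   ((i, j - - L%:Z, b) \in up_triangle 0 0 L) || ((i, j, b) \in up_triangles (- L%:Z) UL).
  rewrite {1}/up_triangles big_cons in_fsetU; congr (_ || _).
  apply/in_up_triangles/in_up_triangles => -[p pT h]; exists p => //; move: h;
  rewrite !in_up_triangle; case: b; lia.
rewrite in_up_triangle /=; have := size_cells; have := z_le; rewrite -/u -/d => h1 h2.
case: (_ \in up_triangles _ _); case: (_ \in down_triangles _ _); case: (absz i \in S);
  by case: b; rewrite ?(andbF, andbT, orbF, orbT); lia.
Qed.

(** The lower half is completed by a corner triangle of side [Rt] at its right end; a half turn then
    puts it on its long base. *)
Lemma below_cut_hexagon (S : seq nat) : {in S, forall i, (i < W)%N} ->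
  M (below (- L%:Z) (cut_hexagon L Rt z k UL DL) `\` row_cells (- L%:Z - 1) false S) =
  M ((trapezoid (Rt + d + z) (k + Rt)
        `\` up_triangles 0 (map (flip_dent W) (((L + k)%N, Rt) :: DL)))
       `\` row_cells 0 true (map (flip W) S)).
Proof.
move=> SW; apply: (@M_rotate _ _ (W%:Z - 1) (- L%:Z - 1)) => i j b.
rewrite in_fsetD in_below !in_fsetD in_fsetU in_polygonE in_trapezoid !in_row_cells.
have -> : ((i, j, b) \in up_triangles (- L%:Z) UL) = (- L%:Z <= j) && ((i, j, b) \in up_triangles (- L%:Z) UL).
  apply/esym/andb_idl => /in_up_triangles[p _]; rewrite in_up_triangle; lia.
have -> : ((W%:Z - 1 - i, - L%:Z - 1 - j, ~~ b) \in up_triangles 0 (map (flip_dent W) (((L + k)%N, Rt) :: DL))) =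
   ((W%:Z - 1 - i, - L%:Z - 1 - j, ~~ b) \in up_triangle 0 0 Rt) || ((i, j, b) \in down_triangles (- L%:Z) DL).
  rewrite {1}/up_triangles big_cons in_fsetU /= subnn; congr (_ || _).
  have E p : p \in DL -> ((i, j, b) \in down_triangle p.1%:Z (- L%:Z) p.2) =
     ((W%:Z - 1 - i, - L%:Z - 1 - j, ~~ b) \in up_triangle (flip_dent W p).1%:Z 0 (flip_dent W p).2).
    case: p => p t pD /=; have : (0 < t)%N -> (p + t <= W)%N.
      move=> p0; have : (p + t).-1 \in cells DL.
        by apply/mem_cells; exists (p, t) => //=; lia.
      by move/rangeD; rewrite /W; lia.
    by rewrite in_down_triangle in_up_triangle; case: b => /=; lia.
  apply/in_up_triangles/in_down_triangles => [[_ /mapP[p pD ->] h]|[p pD h]].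
    by exists p => //; rewrite E.
  by exists (flip_dent W p); [exact: map_f | rewrite -E].
have -> : [&& - L%:Z - 1 - j == 0, ~~ b == true, 0 <= W%:Z - 1 - i & absz (W%:Z - 1 - i)%R \in map (flip W) S]
    = [&& j == - L%:Z - 1, b == false, 0 <= i & absz i \in S].
  apply/and4P/and4P => -[h1 h2 h3 h4]; split; try by [lia | case: b h2].
  - by case/mapP: h4 => x /SW xW; rewrite /flip /W; lia.
  - case/mapP: h4 => x xS; have := SW x xS; rewrite /flip => xW h.
    by rewrite (_ : absz i = x) //; rewrite /W in xW h; lia.
  - by have := SW _ h4; rewrite /W; lia.
  - by apply/mapP; exists (absz i) => //; have := SW _ h4; rewrite /flip; lia.
rewrite in_up_triangle /=; have := size_cells; have := z_le; rewrite -/u -/d /W => h1 h2.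
case: (_ \in up_triangles _ _); case: (_ \in down_triangles _ _); case: (absz i \in S);
  by case: b; rewrite ?(andbF, andbT, orbF, orbT) /=; lia.
Qed.

Lemma cut_hexagon_crossing i :
  (i, - L%:Z, true) \in cut_hexagon L Rt z k UL DL ->
  (i, - L%:Z - 1, false) \in cut_hexagon L Rt z k UL DL -> exists2 n, n \in G & i = n%:Z.
Proof.
rewrite !in_fsetD !in_fsetU !negb_or !in_polygonE => /andP[/andP[nU _] h1] /andP[/andP[_ nD] h2].
exists (absz i); last by lia.
have : absz i \in cells UL ++ cells DL ++ G by rewrite (perm_mem perm_cells) mem_iota; lia.
rewrite !mem_cat => /or3P[|/mem_cells[[p t] pT /= it]|//] => [/mem_cells[[p t] pT /= it]|].
  case/in_up_triangles: nU; exists (p, t) => //; rewrite in_up_triangle /=; lia.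
case/in_down_triangles: nD; exists (p, t) => //; rewrite in_down_triangle /=; lia.
Qed.

(** A trapezoid needs as many dents as rows; for either half this says that exactly [z] lozenges
    cross the cut. *)
Lemma cut_hexagon_count :
  (M (cut_hexagon L Rt z k UL DL) * superfact (L + u + z) * superfact (Rt + d + z) =
   \sum_(S <- sublists G | size S == z)
     vdm ((iota 0 L ++ cells UL) ++ S) * vdm ((iota (L + k) Rt ++ cells DL) ++ S))%N.
Proof.
have ltL : - L%:Z - 1 < - L%:Z by lia.
have N1le : (L + u + z <= L + k)%N by move: size_cells z_le; lia.
have N2le : (Rt + d + z <= k + Rt)%N by move: size_cells z_le; lia.
have tU p : p \in (0%N, L) :: UL -> (p.2 <= L + u + z)%N.
  rewrite inE => /orP[/eqP->|/side_le_cells] /=; rewrite -/u -addnA ?leq_addr // => h.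
  by rewrite addnCA; apply: leq_trans h (leq_addr _ _).
have tD p : p \in ((L + k)%N, Rt) :: DL -> (p.2 <= Rt + d + z)%N.
  rewrite inE => /orP[/eqP->|/side_le_cells] /=; rewrite -/d -addnA ?leq_addr // => h.
  by rewrite addnCA; apply: leq_trans h (leq_addr _ _).
have flipI x y : (L <= x < W)%N -> (L <= y < W)%N ->
    [/\ flip W x = flip W y -> x = y, dist (flip W x) (flip W y) = dist x y
      & (flip W x < k + Rt)%N].
  by rewrite /flip /dist /W => hx hy; split; lia.
have uG : uniq G.
  by apply: subseq_uniq uniq_cells; rewrite catA suffix_subseq.
rewrite (M_cut uG cut_hexagon_crossing) !big_distrl [RHS]big_mkcond /=.
rewrite [LHS]big_seq [RHS]big_seq; apply: eq_bigr => S /sublists_subseq SG.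
have ssUS : subseq (cells UL ++ S) (cells UL ++ cells DL ++ G).
  by apply: cat_subseq => //; exact: subseq_trans SG (suffix_subseq _ _).
have ssDS : subseq (cells DL ++ S) (cells UL ++ cells DL ++ G).
  exact: subseq_trans (cat_subseq (subseq_refl _) SG) (suffix_subseq _ _).
have uUS := subseq_uniq ssUS uniq_cells; have uDS := subseq_uniq ssDS uniq_cells.
have rUS i : i \in cells UL ++ S -> (L <= i < L + k)%N by move/(mem_subseq ssUS)/range.
have rDS i : i \in cells DL ++ S -> (L <= i < L + k)%N by move/(mem_subseq ssDS)/range.
have rS i : i \in S -> (L <= i < L + k)%N by move=> iS; apply: rUS; rewrite mem_cat iS orbT.
have uU' : uniq ((iota 0 L ++ cells UL) ++ S).
  rewrite -catA cat_uniq iota_uniq uUS andbT /=; apply/hasPn => i /rUS.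
  by rewrite mem_iota; lia.
have uD' : uniq ((iota (L + k) Rt ++ cells DL) ++ S).
  rewrite -catA cat_uniq iota_uniq uDS andbT /=; apply/hasPn => i /rDS.
  by rewrite mem_iota; lia.
have rD' i : i \in (iota (L + k) Rt ++ cells DL) ++ S -> (L <= i < W)%N.
  by rewrite -catA mem_cat mem_iota => /orP[|/rDS]; rewrite /W; clear; lia.
have rU' i : i \in (iota 0 L ++ cells UL) ++ S -> (i < L + k)%N.
  rewrite -catA mem_cat mem_iota add0n => /orP[/andP[_ h]|/rUS/andP[]//].
  exact: leq_trans h (leq_addr _ _).
(* Degenerate case: a half has no row but [S] is not empty. Then [z] is 0, no lozenge can cross, and
   both sides vanish. *)
have [c0|c0] := boolP ((S == [::]) || ((0 < L + u + z) && (0 < Rt + d + z))%N); last first.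
  have z0 : z = 0%N by clear - c0; lia.
  rewrite z0 size_eq0; case: ifP => [cS|_]; last by rewrite !mul0n; case: eqP c0.
  case: S c0 cS {SG ssUS ssDS uUS uDS rUS rDS rS uU' uD' rD' rU'} => // i S c0 /=.
  by rewrite !in_fsetD !in_polygonE -/u -/d; clear - c0 z0; lia.
have -> : all (fun i : nat => ((i%:Z, - L%:Z, true) \in cut_hexagon L Rt z k UL DL)
   && ((i%:Z, - L%:Z - 1, false) \in cut_hexagon L Rt z k UL DL)) S.
  apply/allP => i iS; have iLk := rS i iS.
  have iU : i \notin cells UL.
    move: uUS; rewrite cat_uniq => /and3P[_ h _]; apply: contra h => iU.
    by apply/hasP; exists i.
  have iD : i \notin cells DL.
    move: uDS; rewrite cat_uniq => /and3P[_ h _]; apply: contra h => iD.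
    by apply/hasP; exists i.
  have S0 : S != [::] by apply: contraTneq iS => ->.
  rewrite (negPf S0) /= in c0.
  rewrite !in_fsetD !in_fsetU up_triangles_row down_triangles_row (negPf iU) (negPf iD).
  have n2 := @down_triangles_above i%:Z (- L%:Z) (- L%:Z) true DL (lexx _).
  have n3 := @up_triangles_below i%:Z (- L%:Z) (- L%:Z - 1) false UL ltL.
  rewrite (negPf n2) (negPf n3) /=.
  by rewrite !in_polygonE -/u -/d; clear - iLk c0; lia.
rewrite above_cut_hexagon below_cut_hexagon; last first.
  by move=> i /rS /andP[_ h]; apply: leq_trans h _; rewrite /W leq_addr.
rewrite -mulnA mulnACA.
rewrite (@dented_triangles_vdm (L + u + z) (L + k) ((0%N, L) :: UL) S); first last.
- by case/orP: c0 => [->|/andP[->]] //; rewrite orbT.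
- exact: tU.
- exact: rU'.
- exact: uU'.
- exact: N1le.
pose TL := ((L + k)%N, Rt) :: DL.
have rT : {in cells TL, forall i, (i < W)%N}.
  by move=> i iT; have := rD' i; rewrite mem_cat iT => /(_ isT)/andP[].
have pT : perm_eq (cells (map (flip_dent W) TL) ++ map (flip W) S) (map (flip W) (cells TL ++ S)).
  by rewrite map_cat perm_cat2r; exact: cells_flip.
rewrite (@dented_triangles_vdm (Rt + d + z) (k + Rt) (map (flip_dent W) TL)); first last.
- by rewrite -size_eq0 size_map size_eq0; case/orP: c0 => [->|/andP[_ ->]] //; rewrite orbT.
- by move=> p /mapP[q /tD qT ->].
- by move=> i; rewrite (perm_mem pT) => /mapP[x /rD' xW ->]; case: (flipI x x).
- by rewrite (perm_uniq pT) map_inj_in_uniq // => x y /rD' xW /rD' yW; case: (flipI x y).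
- exact: N2le.
rewrite (perm_size pT) size_map (vdm_perm pT) vdm_map; last first.
  by move=> x y /rD' xW /rD' yW; case: (flipI x y).
rewrite /TL ![cells (_ :: _)]/= !size_cat !size_iota -/u -/d !eqn_add2l.
by case: ifP.
Qed.

End Count.
End CutHexagon.

(** * Ferns as lists of triangular dents *)

Section Ferns.
Local Open Scope fset_scope.
Local Open Scope nat_scope.

(** The flag tells whether the current triangle is selected: [true] picks t1, t3, ... and [false]
    picks t2, t4, ..., each with its left end. *)
Fixpoint dents (up : bool) (p : nat) (t : seq nat) : seq (nat * nat) :=
  if t is q :: t' then
    (if up then [:: (p, q)] else [::]) ++ dents (~~ up) (p + q) t'
  else [::].

Lemma dents_cat up p s t :
  dents up p (s ++ t) = dents up p s ++ dents (up (+) odd (size s)) (p + sumn s) t.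
Proof.
elim: s up p => [|q s IH] up p /=; first by rewrite addbF addn0.
by rewrite IH catA addnA addNb addbN.
Qed.

Lemma cells_cat s t : cells (s ++ t) = cells s ++ cells t.
Proof. by rewrite /cells map_cat flatten_cat. Qed.

Lemma cells_cons p q t : cells ((p, q) :: t) = iota p q ++ cells t.
Proof. by []. Qed.

Lemma cells1 p q : cells [:: (p, q)] = iota p q.
Proof. exact: cats0. Qed.

(** The two complementary selections partition the segment of the fern; this is why every fern cell
    is a dent of exactly one half. *)
Lemma count_cells_dents (P : pred nat) up p t :
  count P (cells (dents up p t)) + count P (cells (dents (~~ up) p t)) =
  count P (iota p (sumn t)).
Proof.
elim: t up p => //= q t IH up p; rewrite iotaD !cells_cat !count_cat -(IH up).
by case: up => /=; rewrite cells1 /=; lia.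
Qed.

Lemma size_cells_dents up p t :
  size (cells (dents up p t)) = \sum_(i < size t | odd i != up) nth 0 t i.
Proof.
elim: t up p => [|q t IH] up p /=; first by rewrite big_ord0.
rewrite cells_cat size_cat IH [RHS]big_mkcond big_ord_recl /= -big_mkcond /=.
congr (_ + _); first by case: up; rewrite //= cells1 size_iota.
by apply: eq_big => i; rewrite ?add0n //; case: up; case: (odd i).
Qed.

Lemma osum_dents p t : osum t = size (cells (dents true p t)).
Proof. by rewrite size_cells_dents; apply: eq_bigl => i; case: (odd i). Qed.

Lemma esum_dents p t : esum t = size (cells (dents false p t)).
Proof. by rewrite size_cells_dents; apply: eq_bigl => i; case: (odd i). Qed.

Lemma osum_esum t : osum t + esum t = sumn t.
Proof.
rewrite (osum_dents 0) (esum_dents 0) -!(count_predT (cells _)).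
by rewrite (count_cells_dents predT true) count_predT size_iota.
Qed.

Lemma size_cells_dents_rev up p t :
  size (cells (dents up p (rev t))) = size (cells (dents (up (+) ~~ odd (size t)) 0 t)).
Proof.
have shift up' p' s : size (cells (dents up' p' s)) = size (cells (dents up' 0 s)).
  by rewrite !size_cells_dents.
elim: t up p => [|q t IH] up p //.
rewrite rev_cons -cats1 dents_cat cells_cat size_cat IH size_rev /=.
rewrite !cells_cat !size_cat [X in _ = _ + X]shift addn0 addnC.
by case: up; case: (odd (size t)); rewrite //= !cells1 !size_iota.
Qed.

Lemma cells_dents_shift up p q t :
  cells (dents up (p + q) t) = map (addn p) (cells (dents up q t)).
Proof.
elim: t up q => //= r t IH up q; rewrite !cells_cat map_cat -addnA IH.
by case: up; rewrite //= !cells1 iotaDl.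
Qed.

Lemma up_triangles_cat j s t : up_triangles j (s ++ t) = up_triangles j s `|` up_triangles j t.
Proof. exact: big_cat. Qed.

Lemma down_triangles_cat j s t :
  down_triangles j (s ++ t) = down_triangles j s `|` down_triangles j t.
Proof. exact: big_cat. Qed.

Lemma fernE up (p : nat) (j : int) t :
  fern up p%:Z j t = up_triangles j (dents up p t) `|` down_triangles j (dents (~~ up) p t).
Proof.
elim: t up p => [|q t IH] up p /=.
  by rewrite /up_triangles /down_triangles !big_nil fsetU0.
rewrite -PoszD IH up_triangles_cat down_triangles_cat negbK.
apply/fsetP => x; rewrite !in_fsetU.
case: up => /=; rewrite /up_triangles /down_triangles big_seq1 big_nil in_fset0 /=.
  by rewrite -orbA.
by rewrite orbCA.
Qed.

Lemma s_vdm t : s t * superfact (osum t) = vdm (cells (dents true 0 t)).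
Proof.
rewrite /s; have -> : dented_semihexagon t =
    (trapezoid (osum t) (osum t + esum t) `\` up_triangles 0 (dents true 0 t))
      `\` row_cells 0 true [::].
  rewrite /dented_semihexagon /trapezoid; apply/fsetP => -[[i j] b].
  rewrite !in_fsetD in_row_cells !andbF /=; congr (~~ (_ \in _) && _).
  (* Dropping the first side shifts the start and exchanges the parities, so the induction needs
     both as parameters. *)
  have gen up p : \bigcup_(i <- iota 0 (size t) | odd i != up)
       up_triangle (p + sumn (take i t))%N%:Z 0 (nth 0 t i) = up_triangles 0 (dents up p t).
    elim: (t) up p => [|q t' IH] up p /=; first by rewrite /up_triangles !big_nil.
    rewrite up_triangles_cat -IH big_cons -[1]addn0 iotaDl big_map /=.
    have -> : \bigcup_(i <- iota 0 (size t') | ~~ odd i != up)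
          up_triangle (p + (q + sumn (take i t')))%N%:Z 0 (nth 0 t' i) =
        \bigcup_(i <- iota 0 (size t') | odd i != ~~ up)
          up_triangle (p + q + sumn (take i t'))%N%:Z 0 (nth 0 t' i).
      by apply: eq_big => m; [case: up; case: (odd m) | rewrite addnA].
    by case: up => /=; rewrite ?addn0 /up_triangles ?big_seq1 ?big_nil ?fset0U.
  by rewrite -gen; apply: eq_bigl => i0; case: (odd i0).
have cE P := count_cells_dents P true 0 t.
have pE : perm_eq (cells (dents true 0 t) ++ cells (dents false 0 t)) (iota 0 (sumn t)).
  by apply/permP => P; rewrite count_cat cE.
rewrite dented_triangles_vdm ?cats0 ?leq_addr ?orbT //.
- by rewrite -osum_dents eqxx.
- by have := iota_uniq 0 (sumn t); rewrite -(perm_uniq pE) cat_uniq => /andP[].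
- move=> k kT; have : k \in iota 0 (sumn t) by rewrite -(perm_mem pE) mem_cat kT.
  by rewrite mem_iota osum_esum => /andP[].
- by move=> p /side_le_cells; rewrite -osum_dents.
Qed.

End Ferns.

(** * Separating the crossing lozenges from the fixed dents *)

Section Factorization.
Local Open Scope fset_scope.
Local Open Scope nat_scope.

(** [P] collects the fixed dents of both halves. [S] is dented into both, hence its two factors
    [vdm S]. This is the sum that the region and the cored hexagon share. *)
Definition gap_sum (z : nat) (P G : seq nat) : nat :=
  \sum_(S <- sublists G | size S == z) vdm S * vdm S * cross P S.

Lemma gap_sum_perm z P P' G : perm_eq P P' -> gap_sum z P G = gap_sum z P' G.
Proof. by move=> pP; apply: eq_bigr => S _; rewrite (cross_perm _ pP). Qed.

Lemma cut_hexagon_factor L Rt z k UL DL G :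
  perm_eq (cells UL ++ cells DL ++ G) (iota L k) -> z <= size G ->
  let lu := iota 0 L ++ cells UL in
  let dr := iota (L + k) Rt ++ cells DL in
  M (cut_hexagon L Rt z k UL DL) * superfact (L + size (cells UL) + z)
    * superfact (Rt + size (cells DL) + z) = vdm lu * vdm dr * gap_sum z (lu ++ dr) G.
Proof.
move=> pG zG lu dr; rewrite (cut_hexagon_count Rt pG zG) /gap_sum big_distrr.
apply: eq_bigr => S _; rewrite -/lu -/dr /= !(vdm_cat _ S) cross_catl.
by ring.
Qed.

Lemma prod_dist_iota p n : \prod_(y <- iota p.+1 n) dist p y = n`!.
Proof.
elim: n => [|n IH]; first by rewrite big_nil.
rewrite -[in iota _ _](addn1 n) iotaD big_cat big_seq1 /= IH factS mulnC; congr (_ * _).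
by rewrite /dist; lia.
Qed.

Lemma vdm_iota p n : vdm (iota p n) = superfact n.
Proof.
elim: n p => [|n IH] p; first by rewrite /superfact big_ord0.
by rewrite /= IH prod_dist_iota /superfact big_ord_recr mulnC.
Qed.

(** Split the full interval into consecutive blocks of lengths [A], [h], [c]; the three products of
    distances between blocks occur equally often on both sides. *)
Lemma vdm_two_blocks A h c :
  vdm (iota 0 A ++ iota (A + h) c) * superfact (A + h) * superfact (h + c) =
  superfact A * superfact c * superfact h * superfact (A + h + c).
Proof.
rewrite -(vdm_iota 0 (A + h)) -(vdm_iota A (h + c)) -(vdm_iota 0 (A + h + c)).
rewrite !iotaD !add0n !vdm_cat !vdm_iota cross_catl.
by ring.
Qed.

(** Above the line, c_k, the second gap and b_n are consecutive stretches without dents, hence one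
    entry of the alternating list. The parities of the lengths keep the alternation in step. *)
Lemma upper_dents L h (a b c : seq nat) : ~~ odd (size a) ->
  0 < size c -> ~~ odd (size c) -> 0 < size b ->
  dents true 0 (L :: a ++ h :: take (size c).-1 c
       ++ (last 0 c + h + last 0 b) :: behead (rev b)) =
  (0, L) :: dents false L a ++ dents true (L + sumn a + h) c
    ++ dents false (L + sumn a + h + sumn c + h) (rev b).
Proof.
move=> ea; case/lastP: c => // c ck _; case/lastP: b => // b bn.
rewrite !size_rcons /= negbK => oc _.
rewrite -{1}cats1 take_size_cat // !last_rcons rev_rcons /= add0n; congr (_ :: _).
rewrite dents_cat (negPf ea) /=; congr (_ ++ _).
rewrite dents_cat -cats1 dents_cat oc /= cats0; congr (_ ++ dents _ _ _).
by rewrite sumn_cat /=; lia.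
Qed.

(** Below the line the stretches without dents that merge are a_m, the first gap and c_1, and the
    corner [Rt] closes the list. *)
Lemma lower_dents L h Rt (a b c : seq nat) : 0 < size a -> ~~ odd (size a) ->
  0 < size c -> ~~ odd (size c) -> ~~ odd (size b) ->
  dents true L (take (size a).-1 a ++ (last 0 a + h + head 0 c) :: behead c
            ++ h :: rev b ++ [:: Rt]) =
  (dents true L a ++ dents false (L + sumn a + h) c
    ++ dents true (L + sumn a + h + sumn c + h) (rev b))
    ++ [:: (L + sumn a + h + sumn c + h + sumn b, Rt)].
Proof.
case/lastP: a => // a al _; case: c => // c1 c.
rewrite size_rcons /= !negbK => oa _ oc eb.
rewrite -{1}cats1 take_size_cat // last_rcons -cats1 !dents_cat oa /= cats0.
rewrite -!catA; congr (_ ++ _).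
rewrite dents_cat /= oc /= dents_cat size_rev (negPf eb) /= sumn_rev.
rewrite sumn_cat /= addn0.
have -> : L + sumn a + (al + h + c1) = L + (sumn a + al) + h + c1 by lia.
congr (_ ++ (_ ++ _)); first by congr dents; lia.
by congr [:: (_, _)]; lia.
Qed.

End Factorization.

(** * The two regions of the theorem as cut hexagons *)

Section Regions.
Local Open Scope fset_scope.
Local Open Scope ring_scope.

(** The right fern has even length, so read from the left it begins with the down-pointing triangle
    of side b_n. *)
Definition three_ferns_up (L h : nat) (a c b : seq nat) : seq (nat * nat) :=
  dents false L a ++ dents true (L + sumn a + h) c
    ++ dents false (L + sumn a + h + sumn c + h) (rev b).

Definition three_ferns_down (L h : nat) (a c b : seq nat) : seq (nat * nat) :=
  dents true L a ++ dents false (L + sumn a + h) c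
    ++ dents true (L + sumn a + h + sumn c + h) (rev b).

Lemma size_three_ferns_up L h a c b : ~~ odd (size b) ->
  size (cells (three_ferns_up L h a c b)) = (esum a + osum c + osum b)%N.
Proof.
move=> eb; rewrite !cells_cat !size_cat -esum_dents -osum_dents size_cells_dents_rev.
by rewrite eb /= -osum_dents addnA.
Qed.

Lemma size_three_ferns_down L h a c b : ~~ odd (size b) ->
  size (cells (three_ferns_down L h a c b)) = (osum a + esum c + esum b)%N.
Proof.
move=> eb; rewrite !cells_cat !size_cat -esum_dents -osum_dents size_cells_dents_rev.
by rewrite eb /= -esum_dents addnA.
Qed.

Lemma region_nw_cut (x : nat) (y : int) (z : nat) (a b c : seq nat) (L Rt : nat) :
  let h := ((x + z)./2)%N in
  x = z %[mod 2] -> ~~ odd (size b) ->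
  L%:Z = y + (sumn b)%:Z - (minn (sumn a) (sumn b))%:Z ->
  Rt%:Z = y + (sumn a)%:Z + 1 - (minn (sumn a) (sumn b))%:Z ->
  region_nw x y z a c b =
  cut_hexagon L Rt z (sumn a + h + sumn c + h + sumn b)
    (three_ferns_up L h a c b) (three_ferns_down L h a c b).
Proof.
move=> h hxz eb hL hR.
have hh : (h + h)%N = (x + z)%N by rewrite /h; lia.
have := osum_esum a; have := osum_esum b; have := osum_esum c => sc sb sa.
pose j := - L%:Z.
transitivity (polygon 0 (L + (sumn a + h + sumn c + h + sumn b) + Rt)%N%:Z
   (- (L + Rt + (osum a + esum c + esum b) + z)%N%:Z)
   (esum a + osum c + osum b + z)%N%:Z 0 (sumn a + h + sumn c + h + sumn b)%N%:Z
   `\` fern false L%:Z j a `\` fern true (L + sumn a + h)%N%:Z j c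
   `\` fern false (L + sumn a + h + sumn c + h)%N%:Z j (rev b)).
  rewrite /region_nw /hexagon (negPf eb) -/h {}/j.
  have E (i1 j0 j1 k0 k1 l j l2 l3 i1' j0' j1' k0' k1' l' j' l2' l3' : int) :
      i1 = i1' -> j0 = j0' -> j1 = j1' -> k0 = k0' -> k1 = k1' -> l = l' -> j = j' ->
      l2 = l2' -> l3 = l3' ->
      polygon 0 i1 j0 j1 k0 k1 `\` fern false l j a `\` fern true l2 j c
        `\` fern false l3 j (rev b) =
      polygon 0 i1' j0' j1' k0' k1' `\` fern false l' j' a `\` fern true l2' j' c
        `\` fern false l3' j' (rev b).
    by do 9!move=> ->.
  clearbody h.
  have [ab|ab] := ltnP (sumn a) (sumn b).
    have -> : `|(sumn a)%:Z - (sumn b)%:Z| = (sumn b)%:Z - (sumn a)%:Z by lia.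
    have hm : minn (sumn a) (sumn b) = sumn a by lia.
    rewrite hm in hL hR; clear hm hxz ab eb.
    by apply: E; lia.
  have -> : `|(sumn a)%:Z - (sumn b)%:Z| = (sumn a)%:Z - (sumn b)%:Z by lia.
  have hm : minn (sumn a) (sumn b) = sumn b by lia.
  rewrite hm in hL hR; clear hm hxz ab eb.
  by apply: E; lia.
rewrite /cut_hexagon size_three_ferns_up // size_three_ferns_down //.
rewrite !up_triangles_cat !down_triangles_cat !fernE -/j /=.
apply/fsetP => t; rewrite !in_fsetD !in_fsetU.
by do 6![case: (_ \in _ _ (dents _ _ _)) => //=]; rewrite ?andbF ?andbT.
Qed.

(** The second parameter has the parity opposite to [x] and [z], so the core is shifted northwest by
    half a unit. Its base then lies [A] rows below the west vertex and [A.+1] rows above the east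
    vertex. *)
Lemma cored_hexagon_cut (x z p A : nat) : x = z %[mod 2] ->
  let h := ((x + z)./2)%N in
  cored_hexagon x (2 * A + z + 1) z p =
  cut_hexagon A A.+1 z (h + p + h) [:: ((A + h)%N, p)] [::].
Proof.
move=> hxz h; have hh : (h + h)%N = (x + z)%N by rewrite /h; lia.
rewrite /cored_hexagon /cut_hexagon /core2.
have oz : odd x = odd z by move: hxz; rewrite !modn2; case: (odd x); case: (odd z).
have -> : (odd (2 * A + z + 1) == odd z) = false.
  by rewrite addn1 /= oddD mul2n odd_double /=; case: (odd z).
rewrite oz eqxx /= cells1 size_iota.
rewrite /up_triangles /down_triangles big_seq1 big_nil fsetU0 /hexagon.
have E (i1 j0 j1 k0 k1 l j i1' j0' j1' k0' k1' l' j' : int) :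
    i1 = i1' -> j0 = j0' -> j1 = j1' -> k0 = k0' -> k1 = k1' -> l = l' -> j = j' ->
    polygon 0 i1 j0 j1 k0 k1 `\` up_triangle l j p =
    polygon 0 i1' j0' j1' k0' k1' `\` up_triangle l' j' p.
  by do 7!move=> ->.
clearbody h; clear oz hxz; apply: E => /=; lia.
Qed.

End Regions.

(** * Comparison of the two regions *)

(** The fixed dents of the two halves, corners included, are exactly the complement of the gaps,
    whatever the shapes of the ferns. *)
Lemma perm_full_row L Rt k UL DL G :
  perm_eq (cells UL ++ cells DL ++ G) (iota L k) ->
  perm_eq (((iota 0 L ++ cells UL) ++ (iota (L + k) Rt ++ cells DL)) ++ G) (iota 0 (L + k + Rt)).
Proof.
move=> /permP pG; apply/permP => P; have := pG P.
rewrite !iotaD !add0n !count_cat; lia.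
Qed.

Lemma perm_three_ferns L h (a b c : seq nat) :
  perm_eq (cells (three_ferns_up L h a c b) ++ cells (three_ferns_down L h a c b)
           ++ (iota (L + sumn a) h ++ iota (L + sumn a + h + sumn c) h))
          (iota L (sumn a + h + sumn c + h + sumn b)).
Proof.
apply/permP => P; rewrite !iotaD !cells_cat !addnA !count_cat.
have := count_cells_dents P false L a.
have := count_cells_dents P true (L + sumn a + h) c.
have := count_cells_dents P false (L + sumn a + h + sumn c + h) (rev b).
by rewrite sumn_rev /=; lia.
Qed.

Lemma s_upper L h (a b c : seq nat) : ~~ odd (size a) ->
  (0 < size c)%N -> ~~ odd (size c) -> (0 < size b)%N -> ~~ odd (size b) ->
  (s (L :: a ++ h :: take (size c).-1 c
       ++ (last 0 c + h + last 0 b)%N :: behead (rev b))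
    * superfact (L + size (cells (three_ferns_up L h a c b))))%N =
  vdm (iota 0 L ++ cells (three_ferns_up L h a c b)).
Proof.
move=> ea c0 ec b0 eb; have := s_vdm (L :: a ++ h :: take (size c).-1 c
       ++ (last 0 c + h + last 0 b)%N :: behead (rev b)).
rewrite (osum_dents 0) upper_dents // -/(three_ferns_up L h a c b) cells_cons.
by rewrite size_cat size_iota.
Qed.

Lemma s_lower L h Rt (a b c : seq nat) : (0 < size a)%N -> ~~ odd (size a) ->
  (0 < size c)%N -> ~~ odd (size c) -> ~~ odd (size b) ->
  (s (take (size a).-1 a ++ (last 0 a + h + head 0 c)%N :: behead c
            ++ h :: rev b ++ [:: Rt])
    * superfact (Rt + size (cells (three_ferns_down L h a c b))))%N =
  vdm (iota (L + (sumn a + h + sumn c + h + sumn b)) Rt ++ cells (three_ferns_down L h a c b)).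
Proof.
move=> a0 ea c0 ec eb; set t := _ ++ _; have := s_vdm t.
(* The semihexagon starts at a_1, whereas the left fern starts at abscissa [L]; a translation
   preserves distances. *)
have -> : vdm (cells (dents true 0 t)) = vdm (cells (dents true L t)).
  rewrite -[X in _ = vdm (cells (dents _ X _))]addn0 cells_dents_shift vdm_map // => p q _ _; rewrite /dist; lia.
rewrite (osum_dents L) lower_dents // -/(three_ferns_down L h a c b) cells_cat cells1.
rewrite size_cat size_iota [(_ + Rt)%N]addnC => ->.
by rewrite !addnA; apply: vdm_perm; rewrite perm_catC.
Qed.

Lemma superfact_neq0 n : (superfact n)%:R != 0 :> rat.
Proof.
rewrite pnatr_eq0 -lt0n /superfact; elim/big_ind: _ => // [p q|i _]; last exact: fact_gt0.
by rewrite muln_gt0 => -> ->.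
Qed.

(** [f] is the common gap sum. Both numbers of tilings are expressed as multiples of it, so [f] is
    never inverted. *)
Lemma quotient_algebra (K : fieldType)
    (mr mc s1 s2 f v1 v2 vc h1z h2z h1 h2 hac_z ha1z ha1 hah hhc ha hc hh hahc : K) :
  h1z != 0 -> h2z != 0 -> hac_z != 0 -> ha1z != 0 -> ha1 != 0 -> hah != 0 -> hhc != 0 ->
  ha != 0 -> hc != 0 -> hh != 0 -> hahc != 0 ->
  mr * h1z * h2z = v1 * v2 * f -> mc * hac_z * ha1z = vc * ha1 * f ->
  s1 * h1 = v1 -> s2 * h2 = v2 -> vc * hah * hhc = ha * hc * hh * hahc ->
  mr = mc * s1 * s2 * (hhc / (hc * hh)) * (hah / hahc)
       * (ha1z * hac_z / (h1z * h2z)) * (h1 * h2 / (ha * ha1)).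
Proof.
move=> n1 n2 n3 n4 n5 n6 n7 n8 n9 n10 n11 e1 e2 e3 e4 e5.
have -> : mr = v1 * v2 * f / (h1z * h2z) by rewrite -e1; field; rewrite n1 n2.
have -> : mc = vc * ha1 * f / (hac_z * ha1z) by rewrite -e2; field; rewrite n3 n4.
have -> : vc = ha * hc * hh * hahc / (hah * hhc) by rewrite -e5; field; rewrite n6 n7.
by rewrite -e3 -e4; field; do ?[apply/andP; split].
Qed.

Theorem theorem2p4 (x : nat) (y : int) (z : nat) (a b c : seq nat)
    (hxz : x = z %[mod 2])
    (ha : (0 < size a)%N) (ha2 : ~~ odd (size a))
    (hb : (0 < size b)%N) (hb2 : ~~ odd (size b))
    (hc : (0 < size c)%N) (hc2 : ~~ odd (size c))
    (hy0 : (sumn b <= sumn a)%N -> 0 <= y)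
    (hy1 : (sumn a < sumn b)%N -> -1 <= y) :
  let h := ((x + z)./2)%N in
  let H := hyperfactorial in
  let mu : int := (maxn (sumn a) (sumn b))%:Z in
  let nu : int := (minn (sumn a) (sumn b))%:Z in
  let sa : int := (sumn a)%:Z in
  let sb : int := (sumn b)%:Z in
  let sc : int := (sumn c)%:Z in
  let oa : int := (osum a)%:Z in
  let ob : int := (osum b)%:Z in
  let oc : int := (osum c)%:Z in
  let ec : int := (esum c)%:Z in
  (M (region_nw x y z a c b))%:R =
    (M (cored_hexagon x (absz (2 * y + z%:Z + 2 * mu + 1)%R) z (sumn c)))%:R
    * (s (absz (y + sb - nu)%R :: a ++ h :: take (size c).-1 c
            ++ (last 0 c + h + last 0 b)%N :: behead (rev b)))%:R
    * (s (take (size a).-1 a ++ (last 0 a + h + head 0 c)%N :: behead c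
            ++ h :: rev b ++ [:: absz (y + sa + 1 - nu)%R]))%:R
    * (H (sc + h%:Z) / (H sc * H h%:Z))
    * (H (mu + y + h%:Z) / H (mu + sc + y + h%:Z))
    * (H (mu + y + z%:Z + 1) * H (mu + sc + y + z%:Z)
       / (H (mu - oa + ob + oc + y + z%:Z)
          * H (mu + oa - ob + ec + y + z%:Z + 1)))
    * (H (mu - oa + ob + oc + y) * H (mu + oa - ob + ec + y + 1)
       / (H (mu + y) * H (mu + y + 1)))
  :> rat.
Proof.
move=> h H mu nu sa sb sc oa ob oc ec.
have hh : (h + h)%N = (x + z)%N by rewrite /h; lia.
have zh : (z <= h + h)%N by rewrite hh leq_addl.
set L := absz (y + sb - nu)%R; set Rt := absz (y + sa + 1 - nu)%R.
(* The bounds on [y] make both levels nonnegative, so [absz] changes nothing; for a < b, the value y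
   = -1 still gives [Rt] = 0. *)
have hL : L%:Z = y + sb - nu by rewrite /L /sb /nu; lia.
have hR : Rt%:Z = y + sa + 1 - nu by rewrite /Rt /sa /nu; lia.
(* [A] is where the first gap starts, and so the depth of the cut in the cored hexagon, where the
   left fern is absorbed into the corner. *)
pose A := (L + sumn a)%N.
have hA : A%:Z = mu + y by rewrite /A PoszD hL /mu /sb /nu; lia.
have hRA : (Rt + sumn b)%N = A.+1 by rewrite /A; move: hL hR; rewrite /sa /sb; lia.
have -> : absz (2 * y + z%:Z + 2 * mu + 1)%R = (2 * A + z + 1)%N by lia.
have sup := size_three_ferns_up L h a c hb2.
have sdn := size_three_ferns_down L h a c hb2.
pose u := size (cells (three_ferns_up L h a c b)).
pose d := size (cells (three_ferns_down L h a c b)).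
have HE (e : int) (n : nat) : e = n%:Z -> H e = (superfact n)%:R by move=> ->.
(* The arguments with o_a, o_b, o_c and e_c are the numbers of fixed dents of the halves, corner
   included; adding z gives the numbers of rows. *)
have hu : mu - oa + ob + oc + y = (L + u)%N%:Z.
  by have := osum_esum a; rewrite /u sup; move: hA; rewrite /A /oa /ob /oc; clear; lia.
have hd : mu + oa - ob + ec + y + 1 = (Rt + d)%N%:Z.
  by have := osum_esum b; rewrite /d sdn; move: hA hRA; rewrite /oa /ob /ec; clear; lia.
rewrite (HE (sc + h%:Z) (h + sumn c)%N); last by rewrite /sc; clear; lia.
rewrite (HE sc (sumn c)) // (HE h%:Z h) //.
rewrite (HE (mu + y + h%:Z) (A + h)%N); last by move: hA; clear; lia.
rewrite (HE (mu + sc + y + h%:Z) (A + h + sumn c)%N); last by move: hA; rewrite /sc; clear; lia.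
rewrite (HE (mu + y + z%:Z + 1) (A.+1 + z)%N); last by move: hA; clear; lia.
rewrite (HE (mu + sc + y + z%:Z) (A + sumn c + z)%N); last by move: hA; rewrite /sc; clear; lia.
rewrite (HE (mu - oa + ob + oc + y + z%:Z) (L + u + z)%N); last by rewrite hu -PoszD.
rewrite (HE (mu + oa - ob + ec + y + z%:Z + 1) (Rt + d + z)%N); last first.
  by rewrite addrAC hd -PoszD.
rewrite (HE _ _ hu) (HE _ _ hd) (HE (mu + y) A) //.
rewrite (HE (mu + y + 1) A.+1); last by rewrite -hA -PoszD addn1.
pose k := (sumn a + h + sumn c + h + sumn b)%N.
pose G := iota A h ++ iota (A + h + sumn c) h.
have sG : (z <= size G)%N by rewrite size_cat !size_iota.
have pR : perm_eq (cells (three_ferns_up L h a c b) ++ cells (three_ferns_down L h a c b) ++ G)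
    (iota L k) := perm_three_ferns L h a b c.
have pC : perm_eq (cells [:: ((A + h)%N, sumn c)] ++ cells [::] ++ G) (iota A (h + sumn c + h)).
  by apply/permP => P; rewrite cells1 !iotaD !addnA !count_cat /=; clear; lia.
have fR := cut_hexagon_factor Rt pR sG.
have fC := cut_hexagon_factor A.+1 pC sG.
cbv zeta in fR, fC.
(* Both lists of fixed dents complement the same [G] in rows of the same length, so they are
   permutations of each other and the gap sums agree. *)
have pP := perm_full_row Rt pR; have pQ := perm_full_row A.+1 pC.
have eW : (A + (h + sumn c + h) + A.+1 = L + k + Rt)%N.
  by rewrite -hRA /A /k; clear; lia.
rewrite eW -(permPr pP) perm_cat2r perm_sym in pQ.
rewrite -(gap_sum_perm _ _ pQ) in fC.
rewrite (region_nw_cut c hxz hb2 hL hR) (cored_hexagon_cut (sumn c) A hxz) -/h -/k.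
have eU := s_upper L h ha2 hc hc2 hb hb2.
have eD := s_lower L h Rt ha ha2 hc hc2 hb2.
have eV := vdm_two_blocks A h (sumn c).
rewrite -eU -eD in fR.
rewrite cells1 size_iota [size (cells [::])]/= addn0 cats0 vdm_iota in fC.
move: fR fC eV; set F := gap_sum _ _ _.
move=> /(congr1 (fun n => n%:R : rat)) fR /(congr1 (fun n => n%:R : rat)) fC.
move=> /(congr1 (fun n => n%:R : rat)) eV.
rewrite !natrM in fR fC eV.
by apply: (quotient_algebra _ _ _ _ _ _ _ _ _ _ _ fR fC _ _ eV) => //; exact: superfact_neq0.
Qed.
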